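(* Let $E$ be a Banach lattice. The following are equivalent: (i) $E$ is reflexive; (ii) every norm bounded $uaw$-Cauchy net in $E$ is weakly convergent (to an element of $E$); (iii) every norm bounded $uaw$-Cauchy sequence in $E$ is weakly convergent (to an element of $E$).
   Context: $E_+$ denotes the positive cone of $E$. A net $(x_\alpha)$ in $E$ is unbounded absolutely weakly convergent ($uaw$-convergent) to $x\in E$ if for every $u\in E_+$ the net $(|x_\alpha-x|\wedge u)$ converges to zero weakly. A net $(x_\alpha)$ (in particular, a sequence) is $uaw$-Cauchy if the double net $(x_\alpha-x_\beta)_{(\alpha,\beta)}$, indexed by pairs with the product order, is $uaw$-convergent to $0$. *)

(* Defs.v *)
From HB Require Import structures.
From mathcomp Require Import all_boot all_order all_algebra.
From mathcomp Require Import all_classical all_reals all_analysis.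

Set Implicit Arguments.
Unset Strict Implicit.
Unset Printing Implicit Defensive.

Import Order.TTheory GRing.Theory Num.Theory.
Import numFieldNormedType.Exports.

Local Open Scope classical_set_scope.
Local Open Scope ring_scope.

Section dual.
Context {R : realType} {V : normedModType R}.

Definition dual_pred : {pred V -> R^o} :=
  fun f => `[< linear f /\ continuous f >].

Record dual := Dual {
  dual_fun :> V -> R^o;
  dual_fun_subproof : dual_fun \in dual_pred }.

HB.instance Definition _ := [isSub for dual_fun].
HB.instance Definition _ := [Choice of dual by <:].

Lemma dual_submod_closed : submod_closed dual_pred.
Proof.
split=> [|a f g /asboolP[lf cf] /asboolP[lg cg]]; apply/asboolP; split.
- by move=> a x y; rewrite /= scaler0 addr0.
- exact: cst_continuous.
- move=> b x y; rewrite !fctE lf lg !scalerDr addrACA; congr (_ + _ + _).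
  by rewrite !scalerA mulrC.
- move=> x; apply: (@continuousD _ _ _ (a *: f) g); last exact: cg.
  by apply: (@continuousZl_tmp _ _ _ f a); exact: cf.
Qed.

HB.instance Definition _ :=
  GRing.isSubmodClosed.Build R (V -> R^o) dual_pred dual_submod_closed.
HB.instance Definition _ := [SubChoice_isSubLmodule of dual by <:].

Lemma dual_linear (f : dual) : linear f.
Proof. by have /asboolP[] := dual_fun_subproof f. Qed.

HB.instance Definition _ (f : dual) :=
  GRing.isLinear.Build R V R^o _ f (dual_linear f).

Lemma dual_continuous (f : dual) : continuous f.
Proof. by have /asboolP[] := dual_fun_subproof f. Qed.

Definition dual_norm (f : dual) : R :=
  sup [set `|f x| | x in [set x : V | `|x| <= 1]].

Lemma dual_norm_has_sup (f : dual) :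
  has_sup [set `|f x| | x in [set x : V | `|x| <= 1]].
Proof.
split; first by exists `|f 0|; exists 0 => //=; rewrite normr0.
have := @continuous_linear_bounded _ _ _ 0 f (@dual_continuous f 0).
move=> /linear_boundedP/pinfty_ex_gt0[r r0 fr]; exists r => _ [x /= x1 <-].
by rewrite (le_trans (fr x))// ger_pMr.
Qed.

Lemma ler_dual_norm (f : dual) (x : V) : `|f x| <= dual_norm f * `|x|.
Proof.
have [->|x0] := eqVneq x 0; first by rewrite linear0 !normr0 mulr0.
have nx0 : 0 < `|x| by rewrite normr_gt0.
rewrite -ler_pdivrMr//.
have -> : `|f x| / `|x| = `|f (`|x|^-1 *: x)|.
  by rewrite linearZ/= normrM normfV normr_id mulrC.
apply: ub_le_sup; first by case: (dual_norm_has_sup f).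
by exists (`|x|^-1 *: x) => //=; rewrite normrZ normfV normr_id mulVf ?gt_eqF.
Qed.

Lemma dual_norm_le (f : dual) (M : R) :
  (forall x, `|x| <= 1 -> `|f x| <= M) -> dual_norm f <= M.
Proof.
move=> fM; apply: ge_sup; first by case: (dual_norm_has_sup f).
by move=> _ [x /= x1 <-]; exact: fM.
Qed.

Lemma dual_norm_ge0 (f : dual) : 0 <= dual_norm f.
Proof.
apply: le_trans (normr_ge0 (f 0)) _.
apply: ub_le_sup; first by case: (dual_norm_has_sup f).
by exists 0 => //=; rewrite normr0.
Qed.

Let ler_dual_ball (f : dual) x : `|x| <= 1 -> `|f x| <= dual_norm f.
Proof.
by move=> x1; rewrite (le_trans (ler_dual_norm f x))// ler_piMr ?dual_norm_ge0.
Qed.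

Let dual_normD f g : dual_norm (f + g) <= dual_norm f + dual_norm g.
Proof.
apply: dual_norm_le => x x1.
by rewrite (le_trans (ler_normD (f x) (g x)))// lerD// ler_dual_ball.
Qed.

Let dual_normZ_le a f : dual_norm (a *: f) <= `|a| * dual_norm f.
Proof.
apply: dual_norm_le => x x1.
by rewrite [leLHS]normrM ler_wpM2l// ler_dual_ball.
Qed.

Let dual_normZ a f : dual_norm (a *: f) = `|a| * dual_norm f.
Proof.
have [->|a0] := eqVneq a 0.
  apply/eqP; rewrite eq_le dual_normZ_le andTb normr0 mul0r.
  exact: dual_norm_ge0.
apply/eqP; rewrite eq_le dual_normZ_le andTb -ler_pdivlMl ?normr_gt0//.
rewrite -{1}(scale1r f) -(mulVf a0) -scalerA -normfV.
exact: dual_normZ_le.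
Qed.

Let dual_norm0_eq0 f : dual_norm f = 0 -> f = 0.
Proof.
move=> f0; apply/val_inj/funext => x; apply/normr0_eq0/eqP.
by rewrite eq_le normr_ge0 andbT (le_trans (ler_dual_norm f x))// f0 mul0r.
Qed.

HB.instance Definition _ :=
  Lmodule_isNormed.Build R dual dual_normD dual_normZ dual_norm0_eq0.

End dual.
Arguments dual {R} V.
Arguments dual_pred {R} V.

Section reflexive.
Context {R : realType} {V : normedModType R}.

Lemma bidual_embed_subproof (x : V) :
  (fun f : dual V => f x : R^o) \in dual_pred (dual V).
Proof.
pose phi (f : dual V) : R^o := f x.
have lphi : linear phi by [].
pose HL := GRing.isLinear.Build R (dual V) R^o _ phi lphi.
pose L : {linear dual V -> R^o} := HB.pack phi HL.
apply/asboolP; split => //; apply: (@bounded_linear_continuous _ _ _ L).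
apply/linear_boundedP; exists `|x|; split; first exact: num_real.
move=> r xr f; rewrite (le_trans (ler_dual_norm f x))// mulrC.
by apply: ler_wpM2r; [exact: dual_norm_ge0|exact: ltW].
Qed.

Definition bidual_embed (x : V) : dual (dual V) :=
  Dual (bidual_embed_subproof x).

End reflexive.

Definition reflexive_space {R : realType} (V : normedModType R) : Prop :=
  range (@bidual_embed R V) = [set: dual (dual V)].


(* A lattice order cannot be added to CompleteNormedModule by joining the
   existing structures, because the joins it would create are already taken by
   numDomainType and realDomainType. The mixin therefore carries the raw order
   and lattice operations, and Order.Lattice is instantiated afterwards on the
   sort of banachLatticeType, with display ring_display. *)
HB.mixin Record CompleteNormedModule_isBanachLattice (R : realType) E
    & CompleteNormedModule R E := {
  vle : rel E ;
  vmeet : E -> E -> E ;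
  vjoin : E -> E -> E ;
  vle_refl : reflexive vle ;
  vle_anti : antisymmetric vle ;
  vle_trans : transitive vle ;
  vmeetP : forall x y z : E, vle x (vmeet y z) = vle x y && vle x z ;
  vjoinP : forall x y z : E, vle (vjoin x y) z = vle x z && vle y z ;
  vleD2r : forall z x y : E, vle x y -> vle (x + z) (y + z) ;
  vleZ : forall (a : R) (x y : E), 0 <= a -> vle x y -> vle (a *: x) (a *: y) ;
  vle_norm : forall x y : E,
    vle (vjoin x (- x)) (vjoin y (- y)) -> `|x| <= `|y|
}.

#[short(type="banachLatticeType")]
HB.structure Definition BanachLattice (R : realType) :=
  {E of CompleteNormedModule R E & CompleteNormedModule_isBanachLattice R E}.

Section banach_lattice.
Context {R : realType} {E : banachLatticeType R}.

HB.instance Definition _ := Order.Le_isPOrder.Build ring_display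
  (BanachLattice.sort E) (@vle_refl R E) (@vle_anti R E) (@vle_trans R E).
HB.instance Definition _ := Order.POrder_MeetJoin_isLattice.Build ring_display
  (BanachLattice.sort E) (@vmeetP R E) (@vjoinP R E).

(* The lattice modulus; [`|x|] denotes the norm of x. *)
Definition modulus (x : E) : E := (x `|` - x)%O.

Lemma modulus_ler_norm (x y : E) : modulus x <= modulus y -> `|x| <= `|y|.
Proof. exact: vle_norm. Qed.

End banach_lattice.

Section nets.
Context {I : Type} (le : I -> I -> Prop).

Definition directed : Prop :=
  [/\ inhabited I, (forall i, le i i),
      (forall j i k, le i j -> le j k -> le i k) &
      (forall i j, exists k, le i k /\ le j k)].

Definition tails : set_system I := filter_from setT (fun i => [set j | le i j]).

Definition prod_le (p q : I * I) : Prop := le p.1 q.1 /\ le p.2 q.2.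

Lemma tails_filter : directed -> ProperFilter tails.
Proof.
move=> [[i0] lexx le_trans le_dir]; apply: filter_from_proper.
  apply: filter_from_filter; first by exists i0.
  move=> i j _ _; have [k [ik jk]] := le_dir i j.
  by exists k => // l /= kl; split; exact: le_trans kl.
by move=> i _; exists i; exact: lexx.
Qed.

End nets.

Definition weak_cvg {R : realType} {V : normedModType R} {I : Type}
    (le : I -> I -> Prop) (x : I -> V) (l : V) : Prop :=
  forall f : dual V, f (x i) @[i --> tails le] --> f l.

Definition uaw_cvg {R : realType} {E : banachLatticeType R} {I : Type}
    (le : I -> I -> Prop) (x : I -> E) (l : E) : Prop :=
  forall u : E, 0 <= u -> weak_cvg le (fun i => modulus (x i - l) `&` u)%O 0.

Definition uaw_cauchy {R : realType} {E : banachLatticeType R} {I : Type}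
    (le : I -> I -> Prop) (x : I -> E) : Prop :=
  uaw_cvg (prod_le le) (fun p => x p.1 - x p.2) 0.

(* Main.v *)
Require Import Defs.
From HB Require Import structures.
From mathcomp Require Import all_boot all_order all_algebra.
From mathcomp Require Import all_classical all_reals all_analysis.
From mathcomp Require Import ring lra.

(** Two properties of a Banach lattice E carry the proof.
    - [ball_almost_order_bounded]: for every positive functional f and every
      e > 0 some u >= 0 satisfies f((x - u)^+) <= e for all x >= 0 in the unit
      ball. By disjointification ([disjoint_null_almost_order_bounded]) it
      holds as soon as no positive functional stays away from 0 along a norm
      bounded disjoint sequence of positive vectors.
    - [monotone_complete]: norm bounded increasing sequences converge in norm.

    Reflexivity gives convergence of nets. Suppose that (w_n) is bounded,
    positive and disjoint with f(w_n) >= d > 0. By reflexivity it has a weak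
    limit x >= 0 along an ultrafilter, and f(x) >= d. The component of f
    carried by w_m vanishes at the later w_n, hence at x, so f(w_m /\ x) = 0;
    therefore the component of f carried by x vanishes at every w_m, hence at
    x, where it equals f(x). This contradiction ([reflexive_disjoint_null])
    yields the first property. For a bounded uaw-Cauchy net (x_i) and
    d = |x_i - x_j|, the sum f(d) = f(d /\ u) + f((d - u)^+) is then eventually
    small, so that f(x_i) converges for every f; the limit, as a function of
    f, is an element of the bidual, that is, of E ([reflexive_nets_converge]).

    Convergence of sequences gives reflexivity. If (w_n) is bounded, positive
    and disjoint, then the f(w_n /\ u) are summable, because finite disjoint
    sums of minorants of u stay below u. So (w_n) interleaved with zeros is
    uaw-Cauchy, and its weak limit can only be 0 ([sequences_disjoint_null]).
    An increasing bounded sequence is weakly Cauchy, hence uaw-Cauchy, hence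
    weakly convergent, hence norm convergent by a Dini argument
    ([increasing_weak_cvg]). Thus E has both properties, and it remains to
    represent a positive T in the bidual ([nneg_bidual_represented]). Among
    the x >= 0 with g(x) <= T(g) for all g >= 0 there is a maximal one. If
    T - x were not 0, a Radon-Nikodym argument ([minorant]) would produce a
    nonzero z >= 0 below T - x, against maximality: a Hahn decomposition in
    the dual gives a functional g0 below which T - x dominates a multiple
    t u of some u in E, and z is t times the part of u that is carried by g0.

    Maximal elements come from an exhaustion along sequences
    ([maximal_element]), since sequences are what the hypotheses make
    converge. *)

Set Implicit Arguments.
Unset Strict Implicit.
Unset Printing Implicit Defensive.

Import Order.TTheory GRing.Theory Num.Theory.
Import numFieldNormedType.Exports.

Local Open Scope classical_set_scope.
Local Open Scope ring_scope.

(** * Arithmetic of vector lattices *)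

Section vector_lattice.
Context {R : realType} {E : banachLatticeType R}.
Implicit Types (x y z t u : E) (a : R).

Lemma leD2r z x y : (x + z <= y + z) = (x <= y).
Proof.
apply/idP/idP => [/(vleD2r (- z))|/(vleD2r z)//].
by rewrite !addrK.
Qed.

Lemma leD2l z x y : (z + x <= z + y) = (x <= y).
Proof. by rewrite ![z + _]addrC leD2r. Qed.

Lemma leB0 x y : (0 <= y - x) = (x <= y).
Proof. by rewrite -(leD2r x 0) add0r subrK. Qed.

Lemma leN2 x y : (- x <= - y) = (y <= x).
Proof. by rewrite -(leB0 (- x)) opprK addrC leB0. Qed.

Lemma leDD x y z t : x <= y -> z <= t -> x + z <= y + t.
Proof.
by move=> xy zt; apply: (@le_trans _ _ (y + z)); rewrite ?leD2r ?leD2l.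
Qed.

Lemma addE_ge0 x y : 0 <= x -> 0 <= y -> 0 <= x + y.
Proof. by move=> x0 y0; rewrite -[0]addr0 leDD. Qed.

Lemma leBlDr x y z : (x - y <= z) = (x <= z + y).
Proof. by rewrite -(leD2r y (x - y)) subrK. Qed.

Lemma leZ a x y : 0 <= a -> x <= y -> a *: x <= a *: y.
Proof. exact: vleZ. Qed.

Lemma scaleE_ge0 a x : 0 <= a -> 0 <= x -> 0 <= a *: x.
Proof. by move=> a0 /(leZ a0); rewrite scaler0. Qed.

Lemma leZ2 a x y : 0 < a -> (a *: x <= a *: y) = (x <= y).
Proof.
move=> a0; apply/idP/idP => [|/(leZ (ltW a0))//].
have /ltW ai0 : 0 < a^-1 by rewrite invr_gt0.
by move=> /(leZ ai0); rewrite !scalerA mulVf ?gt_eqF// !scale1r.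
Qed.

Lemma scaleE_le x a b : 0 <= x -> a <= b -> a *: x <= b *: x.
Proof.
by move=> x0 ab; rewrite -leB0 -scalerBl scaleE_ge0// subr_ge0.
Qed.

Lemma leE_eq x y : (forall z, (x <= z) = (y <= z)) -> x = y.
Proof. by move=> xy; apply/le_anti; rewrite xy lexx -xy lexx. Qed.

Lemma geE_eq x y : (forall z, (z <= x) = (z <= y)) -> x = y.
Proof. by move=> xy; apply/le_anti; rewrite xy lexx -xy lexx. Qed.

Lemma joinDr z x y : (x `|` y)%O + z = ((x + z) `|` (y + z))%O.
Proof.
by apply: leE_eq => t; rewrite -(subrK z t) leD2r !leUx !leD2r.
Qed.

Lemma meetDr z x y : (x `&` y)%O + z = ((x + z) `&` (y + z))%O.
Proof.
by apply: geE_eq => t; rewrite -(subrK z t) leD2r !lexI !leD2r.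
Qed.

Lemma oppU x y : - (x `|` y)%O = (- x `&` - y)%O.
Proof.
by apply: geE_eq => t; rewrite lexI -[t]opprK !leN2 leUx.
Qed.

Lemma joinZ a x y : 0 < a -> a *: (x `|` y)%O = (a *: x `|` a *: y)%O.
Proof.
move=> a0; apply: leE_eq => t; rewrite leUx.
have -> : t = a *: (a^-1 *: t) by rewrite scalerA mulfV ?gt_eqF// scale1r.
by rewrite !leZ2// leUx.
Qed.

Lemma meetZ a x y : 0 < a -> a *: (x `&` y)%O = (a *: x `&` a *: y)%O.
Proof.
move=> a0; apply: geE_eq => t; rewrite lexI.
have -> : t = a *: (a^-1 *: t) by rewrite scalerA mulfV ?gt_eqF// scale1r.
by rewrite !leZ2// lexI.
Qed.

Lemma increasing_le (y : nat -> E) m n :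
  (forall n, y n <= y n.+1) -> (m <= n)%N -> y m <= y n.
Proof.
move=> yS; elim: n => [|n IH]; first by rewrite leqn0 => /eqP ->.
rewrite leq_eqVlt => /predU1P[->//|]; rewrite ltnS => /IH/le_trans; apply.
exact: yS.
Qed.

Definition pos x : E := (x `|` 0)%O.

Lemma pos_ge0 x : 0 <= pos x. Proof. exact: leUr. Qed.

Lemma le_pos x : x <= pos x. Proof. exact: leUl. Qed.

Lemma pos_le x y : x <= y -> 0 <= y -> pos x <= y.
Proof. by move=> xy y0; rewrite leUx xy. Qed.

Lemma pos_homo x y : x <= y -> pos x <= pos y.
Proof. by move=> xy; rewrite pos_le ?pos_ge0// (le_trans xy)// le_pos. Qed.

Lemma ge0_pos x : 0 <= x -> pos x = x.
Proof. by move=> x0; exact: join_l. Qed.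

Lemma posZ a x : 0 < a -> pos (a *: x) = a *: pos x.
Proof. by move=> a0; rewrite /pos joinZ// scaler0. Qed.

Lemma posD x y : pos (x + y) <= pos x + pos y.
Proof. by rewrite pos_le ?leDD ?le_pos ?addE_ge0 ?pos_ge0. Qed.

Lemma posN x : pos (- x) = pos x - x.
Proof. by rewrite /pos joinDr subrr add0r joinC. Qed.

Lemma pos_decomp x : x = pos x - pos (- x).
Proof. by rewrite posN subKr. Qed.

Lemma joinE x y : (x `|` y)%O = pos (x - y) + y.
Proof. by rewrite /pos joinDr subrK add0r. Qed.

Lemma meetE x y : (x `&` y)%O = x - pos (x - y).
Proof. by rewrite oppU opprB oppr0 [RHS]addrC meetDr subrK add0r meetC. Qed.

Lemma meet_add_pos x y : (x `&` y)%O + pos (x - y) = x.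
Proof. by rewrite meetE subrK. Qed.

Lemma join_add_meet x y : (x `|` y)%O + (x `&` y)%O = x + y.
Proof.
by rewrite joinE meetE; set p := pos _; rewrite (addrC p) addrACA subrr addr0
  addrC.
Qed.

Lemma modulusE x : modulus x = pos x + pos (- x).
Proof.
rewrite /modulus joinE opprK -mulr2n -scaler_nat posZ// scaler_nat mulr2n.
by rewrite posN addrA.
Qed.

Lemma modulus_ge0 x : 0 <= modulus x.
Proof. by rewrite modulusE addE_ge0// pos_ge0. Qed.

Lemma le_modulus x : x <= modulus x. Proof. exact: leUl. Qed.

Lemma leN_modulus x : - x <= modulus x. Proof. exact: leUr. Qed.

Lemma pos_le_modulus x : pos x <= modulus x.
Proof. by rewrite pos_le ?le_modulus ?modulus_ge0. Qed.

Lemma leNE x : 0 <= x -> - x <= x.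
Proof. by move=> x0; apply: le_trans (x0); rewrite -(leN2 0) opprK oppr0. Qed.

Lemma ge0_modulus x : 0 <= x -> modulus x = x.
Proof. by move=> x0; apply: join_l; exact: leNE. Qed.

Lemma modulusN x : modulus (- x) = modulus x.
Proof. by rewrite /modulus opprK joinC. Qed.

Lemma modulusB_le x y : 0 <= x -> 0 <= y -> modulus (x - y) <= x + y.
Proof.
move=> x0 y0; rewrite leUx leD2l leNE//= opprB [x + y]addrC leD2l.
exact: leNE.
Qed.

Lemma pos_meet_posN x : (pos x `&` pos (- x))%O = 0.
Proof.
by rewrite meetE -pos_decomp subrr.
Qed.

Lemma meet_ge0 x y : 0 <= x -> 0 <= y -> 0 <= (x `&` y)%O.
Proof. by move=> x0 y0; rewrite lexI x0. Qed.

Lemma meetD_le x y u : 0 <= x -> 0 <= y -> 0 <= u ->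
  ((x + y) `&` u <= (x `&` u)%O + (y `&` u)%O)%O.
Proof.
move=> x0 y0 u0; rewrite meetDr lexI ![_ + (y `&` u)%O]addrC !meetDr !lexI.
rewrite [y + x]addrC leIl /= [u + x]addrC.
have leDu t : 0 <= t -> ((x + y) `&` u)%O <= t + u.
  by move=> t0; rewrite (le_trans (leIr _ _))// -[leLHS]add0r leD2r.
by rewrite !leDu// addrC leDu.
Qed.

Lemma ler_normE x y : 0 <= x -> x <= y -> `|x| <= `|y|.
Proof.
move=> x0 xy; apply: modulus_ler_norm.
by rewrite !ge0_modulus// (le_trans x0).
Qed.

Lemma ler_norm_pos x : `|pos x| <= `|x|.
Proof.
by apply: modulus_ler_norm; rewrite ge0_modulus ?pos_ge0// pos_le_modulus.
Qed.

Lemma norm_modulus x : `|modulus x| = `|x|.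
Proof.
by apply/le_anti/andP; split; apply: modulus_ler_norm;
  rewrite (ge0_modulus (modulus_ge0 x)).
Qed.

End vector_lattice.

(** * Domination by a sublinear functional *)

Section hahn_banach.
Context {R : realType} {V : lmodType R}.
Implicit Types p : V -> R.

(** Homogeneity is asked as an inequality only: used for the inverse scalar as
    well, it gives the equality. *)
Definition sublinear p :=
  (forall x y, p (x + y) <= p x + p y) /\
  (forall a x, 0 < a -> p (a *: x) <= a * p x).

Lemma sublinearZ p a x : sublinear p -> 0 < a -> p (a *: x) = a * p x.
Proof.
move=> [_ pZ] a0; apply/le_anti; rewrite pZ//=.
rewrite -ler_pdivlMl// -[in leLHS](scale1r x) -(mulVf (lt0r_neq0 a0)).
by rewrite -scalerA pZ// invr_gt0.
Qed.

Lemma sublinear0 p : sublinear p -> p 0 = 0.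
Proof.
move=> sp; have := @sublinearZ p 2 0 sp (ltr0Sn _ _).
by rewrite scaler0; lra.
Qed.

Lemma sublinearN p x : sublinear p -> - p (- x) <= p x.
Proof.
move=> sp; rewrite lerNl -subr_ge0 opprK addrC -(sublinear0 sp) -(subrr x).
exact: sp.1.
Qed.

(** Covers the two infima used in the next proof, over a chain of functionals
    and over a half-line of parameters, and the one of [decreasing_support];
    the minorant b keeps the infimum finite. *)
Lemma sublinear_inf (I : Type) (A : set I) (q : I -> V -> R) (b : V -> R) :
  A !=set0 -> (forall i x, A i -> b x <= q i x) ->
  (forall i j x y, A i -> A j -> exists2 k, A k & q k (x + y) <= q i x + q j y)
    ->
  (forall i a x, A i -> 0 < a -> exists2 k, A k & q k (a *: x) <= a * q i x) ->
  sublinear (fun x => inf [set q i x | i in A]).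
Proof.
move=> [i0 Ai0] bq qD qZ.
have lb x : has_lbound [set q i x | i in A] by exists (b x) => _ [i Ai <-];
  exact: bq.
have hi x : has_inf [set q i x | i in A].
  by split => //; exists (q i0 x); exists i0.
split=> [x y|a x a0].
  apply/ler_addgt0Pr => e e0.
  have e20 : 0 < e / 2 by rewrite divr_gt0.
  have [_ [i Ai <-] qi] := inf_adherent e20 (hi x).
  have [_ [j Aj <-] qj] := inf_adherent e20 (hi y).
  have [k Ak qk] := qD i j x y Ai Aj.
  have : inf [set q i (x + y) | i in A] <= q k (x + y) by apply: ge_inf => //;
    exists k.
  by lra.
rewrite -ler_pdivrMl//; apply: lb_le_inf; first by exists (q i0 x); exists i0.
move=> _ [i Ai <-]; rewrite ler_pdivrMl//.
have [k Ak qk] := qZ i a x Ai a0; apply: le_trans qk.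
by apply: ge_inf => //; exists k.
Qed.

(** Zorn's lemma provides a minimal sublinear functional q below p. For fixed
    a, the infimum over t >= 0 of q(x + ta) - t q(a) is again sublinear and
    below q, so it equals q; this says q(x) + q(a) <= q(x + a), and a sublinear
    functional that is also superadditive is linear. *)
Theorem hahn_banach p : sublinear p ->
  exists2 f : V -> R, (forall a x y, f (a *: x + y) = a * f x + f y) & forall
    x, f x <= p x.
Proof.
move=> sp.
pose T := {q : V -> R | sublinear q /\ forall x, q x <= p x}.
pose le (q r : T) : bool := `[< forall x, sval r x <= sval q x >].
have lb (q : T) x : - p (- x) <= sval q x.
  case: q => q [sq qp] /=; apply: le_trans (sublinearN x sq).
  by rewrite lerN2.
have [||||[q [sq qp]] qmin] := @Zorn T le.
- by move=> q; apply/asboolP.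
- move=> q r s /asboolP qr /asboolP rs; apply/asboolP => x.
  exact: le_trans (rs x) (qr x).
- move=> [q Hq] [r Hr] /asboolP /= qr /asboolP /= rq;
  apply/eq_exist/funext => x.
  by apply/le_anti; rewrite qr rq.
- move=> A totA.
  have [[q0 Aq0]|A0] := pselect (A !=set0); last first.
    by exists (exist _ p (conj sp (fun=> lexx _))) => q Aq; case: A0; exists q.
  pose m x := inf [set sval q x | q in A].
  have lbA x : has_lbound [set sval q x | q in A] by exists (- p (- x)) => _ [q
    _ <-].
  have mA q x : A q -> m x <= sval q x by move=> Aq; apply: ge_inf => //;
    exists q.
  have sm : sublinear m.
    apply: (@sublinear_inf _ A (fun q : T => sval q) (fun x => - p (- x))).
    - by exists q0.
    - by move=> i x _; exact: lb.
    - move=> i j x y Ai Aj; have [/asboolP ij|/asboolP ji] := totA _ _ Ai Aj.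
        exists j => //; case: (svalP j) => -[jD _] _;
          apply: le_trans (jD _ _) _.
        by rewrite lerD2r.
      exists i => //; case: (svalP i) => -[iD _] _; apply: le_trans (iD _ _) _.
      by rewrite lerD2l.
    - by move=> i a x Ai a0; exists i => //; case: (svalP i) => -[_ iZ] _;
      exact: iZ.
  have mp x : m x <= p x.
    by apply: le_trans (mA _ x Aq0) _; case: (svalP q0).
  by exists (exist _ m (conj sm mp)) => q Aq; apply/asboolP => x; exact: mA.
have qadd x a : q x + q a <= q (x + a).
  pose r x := inf [set q (x + t *: a) - t * q a | t in [set t | 0 <= t]].
  have lbt t y : 0 <= t -> - q (- y) <= q (y + t *: a) - t * q a.
    rewrite le_eqVlt => /predU1P[<-|t0].
      by rewrite scale0r addr0 mul0r subr0 sublinearN.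
    rewrite -(sublinearZ _ sq t0); have := sq.1 (y + t *: a) (- y).
    by rewrite addrAC subrr add0r; lra.
  have rt t y : 0 <= t -> r y <= q (y + t *: a) - t * q a.
    move=> t0; apply: ge_inf; last by exists t.
    by exists (- q (- y)) => _ [s s0 <-]; exact: lbt.
  have sr : sublinear r.
    apply: (@sublinear_inf _ [set t : R | 0 <= t] (fun t x => q (x + t *:
      a) - t * q a) (fun x => - q (- x))).
    - by exists 0 => /=.
    - by move=> t y t0; exact: lbt.
    - move=> s t y z s0 t0; exists (s + t); first exact: addr_ge0.
      by rewrite scalerDl addrACA mulrDl; have :=
        sq.1 (y + s *: a) (z + t *: a); lra.
    - move=> s c y s0 c0; exists (c * s); first by rewrite /= mulr_ge0// ltW.
      by rewrite -scalerA -scalerDr mulrBr mulrA lerD2r sq.2.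
  have rq y : r y <= q y by have := rt 0 y (lexx 0);
    rewrite scale0r addr0 mul0r subr0.
  have rp y : r y <= p y by apply: le_trans (rq y) (qp y).
  have /(congr1 sval)/= rE := qmin (exist _ r (conj sr rp)) (asboolT rq).
  by have := rt 1 x ler01; rewrite rE scale1r mul1r; lra.
have qD x y : q (x + y) = q x + q y.
  by apply/le_anti; rewrite qadd sq.1.
have qN x : q (- x) = - q x.
  by apply/eqP; rewrite -addr_eq0 -qD addrC subrr sublinear0.
exists q => // a x y; rewrite qD; congr (_ + _).
have [a0|a0|->] := ltgtP a 0; last by rewrite scale0r mul0r sublinear0.
- by rewrite -[a in LHS]opprK scaleNr qN sublinearZ ?oppr_gt0// mulNr opprK.
- exact: sublinearZ.
Qed.

End hahn_banach.

(** * Lattice cones and their duals *)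

Section dual_construction.
Context {R : realType} {V : normedModType R}.

Lemma dual_of_linear (F : V -> R) (M : R) :
  (forall a x y, F (a *: x + y) = a * F x + F y) ->
  (forall x, `|F x| <= M * `|x|) -> exists f : dual V, forall x, f x = F x.
Proof.
move=> Flin FM; pose phi : V -> R^o := F.
have lphi : linear phi by move=> a x y; exact: Flin.
pose HL := GRing.isLinear.Build R V R^o _ phi lphi.
pose L : {linear V -> R^o} := HB.pack phi HL.
have Fd : phi \in dual_pred V.
  apply/asboolP; split => //; apply: (@bounded_linear_continuous _ _ _ L).
  apply/linear_boundedP; exists M; split; first exact: num_real.
  move=> r Mr x; apply: le_trans (FM x) _.
  by rewrite ler_wpM2r// ltW.
by exists (Dual Fd).
Qed.

Lemma dualD (f : dual V) x y : f (x + y) = f x + f y.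
Proof. exact: linearD. Qed.

Lemma dualB (f : dual V) x y : f (x - y) = f x - f y.
Proof. exact: linearB. Qed.

Lemma dualN (f : dual V) x : f (- x) = - f x.
Proof. exact: linearN. Qed.

Lemma dualZ (f : dual V) a x : f (a *: x) = a * f x.
Proof. exact: linearZ. Qed.

Lemma dual0 (f : dual V) : f 0 = 0.
Proof. exact: linear0. Qed.

Lemma dualED (f g : dual V) x : (f + g) x = f x + g x. Proof. by []. Qed.
Lemma dualEB (f g : dual V) x : (f - g) x = f x - g x. Proof. by []. Qed.
Lemma dualEZ (f : dual V) a x : (a *: f) x = a * f x. Proof. by []. Qed.

Lemma dual_eqP (f g : dual V) : (forall x, f x = g x) -> f = g.
Proof. by move=> fg; apply/val_inj/funext. Qed.

Lemma ler_dual (f : dual V) x : f x <= `|f| * `|x|.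
Proof. exact: le_trans (ler_norm _) (ler_dual_norm f x). Qed.

End dual_construction.

Section lattice_cones.
Context {R : realType}.

(** A lattice order on a normed space, given by its cone P of positive elements:
    every v has a least upper bound with 0. The constants K are left
    unspecified so that the structure is inherited by the dual cone, hence
    available on E, on its dual and on its bidual. *)
Record lattice_cone (V : normedModType R) (P : V -> Prop) : Prop := {
  lconeD : forall x y, P x -> P y -> P (x + y) ;
  lconeZ : forall (a : R) x, 0 <= a -> P x -> P (a *: x) ;
  lcone_sup : exists K : R, forall v, exists p,
    [/\ P p, P (p - v), `|p| <= K * `|v| &
        forall q, P q -> P (q - v) -> P (q - p)] ;
  lcone_norm : exists K : R, forall x y, P x -> P (y - x) -> `|x| <= K * `|y| }.

Definition dual_cone (V : normedModType R) (P : V ->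
  Prop) (f : dual V) : Prop :=
  forall x, P x -> 0 <= f x.

Section extension.
Context {V : normedModType R} {P : V -> Prop} (HP : lattice_cone P).

Lemma lcone0 : P 0.
Proof.
have [_ /(_ 0)[p [Pp _ _ _]]] := lcone_sup HP.
by rewrite -(scale0r p); apply: lconeZ.
Qed.

Lemma lcone_sup_ge0 : exists2 K : R, 0 <= K & forall v, exists p,
  [/\ P p, P (p - v), `|p| <= K * `|v| &
      forall q, P q -> P (q - v) -> P (q - p)].
Proof.
have [K HK] := lcone_sup HP; exists `|K| => // v.
have [p [Pp Pv pK pmin]] := HK v; exists p; split => //.
by rewrite (le_trans pK)// ler_wpM2r// ler_norm.
Qed.

(** Writing v = p - q with p and q in P, the value F(p) - F(q) does not depend
    on the decomposition. Superhomogeneity is enough, because applied to the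
    inverse scalar it gives the reverse inequality. *)
Lemma cone_extension (F : V -> R) (M : R) :
  (forall x y, P x -> P y -> F (x + y) = F x + F y) ->
  (forall a x, 0 < a -> P x -> a * F x <= F (a *: x)) ->
  (forall x, P x -> `|F x| <= M * `|x|) ->
  exists f : dual V, forall x, P x -> f x = F x.
Proof.
move=> FD FZ FM.
have F0 : F 0 = 0.
  by have := FD 0 0 lcone0 lcone0; rewrite addr0; lra.
have {}FZ a x : 0 <= a -> P x -> F (a *: x) = a * F x.
  rewrite le_eqVlt => /predU1P[<- _|a0 Px]; first by rewrite scale0r mul0r.
  have Pax : P (a *: x) by apply: lconeZ => //; exact: ltW.
  apply/le_anti; rewrite FZ// andbT.
  have ai0 : 0 < a^-1 by rewrite invr_gt0.
  by rewrite -ler_pdivrMl// (le_trans (FZ _ _ ai0 Pax))//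
    scalerA mulVf ?gt_eqF// scale1r.
have FB x y p q : P x -> P y -> P p -> P q -> x - y = p - q ->
  F x - F y = F p - F q.
  move=> Px Py Pp Pq /eqP; rewrite subr_eq addrAC eq_sym subr_eq => /eqP pq.
  by have := congr1 F pq; rewrite !FD//; lra.
have [K HK] := lcone_sup HP.
have /choice[pos posP] := HK.
pose G x := F (pos x) - F (pos x - x).
have GE x p q : P p -> P q -> x = p - q -> G x = F p - F q.
  by have [Pp Pq _ _] := posP x => ? ? xE; apply: FB => //; rewrite subKr.
have GD x y : G (x + y) = G x + G y.
  have [Px Px' _ _] := posP x; have [Py Py' _ _] := posP y.
  rewrite (@GE (x + y) (pos x + pos y) ((pos x - x) + (pos y - y))).
  - by rewrite (FD _ _ Px Py) (FD _ _ Px' Py') /G; lra.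
  - exact: (lconeD HP).
  - exact: (lconeD HP).
  - by rewrite opprD !opprB addrACA !subrKC.
have GN x : G (- x) = - G x.
  have [Px Px' _ _] := posP x.
  by rewrite (@GE (- x) (pos x - x) (pos x)) /G ?opprB// addrAC subrr add0r.
have GZp a x : 0 <= a -> G (a *: x) = a * G x.
  move=> a0; have [Px Px' _ _] := posP x.
  rewrite (@GE _ (a *: pos x) (a *: (pos x - x))).
  - by rewrite !FZ// mulrBr.
  - exact: (lconeZ HP).
  - exact: (lconeZ HP).
  - by rewrite -scalerBr subKr.
have GZ a x : G (a *: x) = a * G x.
  have [a0|a0] := leP 0 a; first exact: GZp.
  by rewrite -[a in LHS]opprK scaleNr GN GZp ?oppr_ge0 ?ltW// mulNr opprK.
have [f fG] : exists f : dual V, forall x, f x = G x.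
  apply: (@dual_of_linear _ _ _ (`|M| * (K + (K + 1)))) => [a x y|x].
    by rewrite GD GZ.
  have [Px Px' Kx _] := posP x.
  rewrite /G (le_trans (ler_normB _ _))//.
  have M' (y : V) : M * `|y| <= `|M| * `|y| by rewrite ler_wpM2r// ler_norm.
  have := le_trans (FM _ Px) (M' _); have := le_trans (FM _ Px') (M' _).
  have : `|M| * `|pos x - x| <= `|M| * ((K + 1) * `|x|).
    by rewrite ler_wpM2l// (le_trans (ler_normB _ _))// mulrDl mul1r lerD2r.
  have : `|M| * `|pos x| <= `|M| * (K * `|x|) by rewrite ler_wpM2l.
  by lra.
exists f => x Px; rewrite fG (@GE x x 0) ?F0 ?subr0//.
exact: lcone0.
Qed.

End extension.

Section dual.
Context {V : normedModType R} {P : V -> Prop} (HP : lattice_cone P).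

(** The Riesz decomposition property: w is the minimum of z and x, written as
    z - (z - x)^+. *)
Lemma lcone_decomp (x y z : V) : P x -> P y -> P z -> P (x + y - z) ->
  exists2 w, P w /\ P (x - w) & P (z - w) /\ P (y - (z - w)).
Proof.
move=> Px Py Pz xyz; have [K /(_ (z - x))[p [Pp Ppx _ pmin]]] := lcone_sup HP.
exists (z - p); rewrite ?subKr; split => //.
- by apply: pmin => //; rewrite subKr.
- by move: Ppx; rewrite !opprB addrCA addrC addrAC [p + x]addrC.
- by apply: pmin => //; rewrite opprB addrA [y + x]addrC.
Qed.

Lemma dual_cone_norm : exists K : R, forall f g : dual V,
  dual_cone P f -> dual_cone P (g - f) -> `|f| <= K * `|g|.
Proof.
have [K K0 HK] := lcone_sup_ge0 HP; exists (K + (K + 1)) => f g f0 fg.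
apply: dual_norm_le => x x1.
have [p [Pp Px Kp _]] := HK x.
have -> : f x = f p - f (p - x) by rewrite dualB subKr.
rewrite (le_trans (ler_normB _ _))//.
rewrite !ger0_norm; [|exact: f0..].
have := fg _ Pp; have := fg _ Px; rewrite !dualEB.
have := ler_dual g p; have := ler_dual g (p - x).
have Kp' : `|p| <= K by rewrite (le_trans Kp)// ler_piMr.
have : `|g| * `|p - x| <= `|g| * (K + 1).
  by rewrite ler_wpM2l// (le_trans (ler_normB _ _))// lerD.
have : `|g| * `|p| <= `|g| * K by rewrite ler_wpM2l.
lra.
Qed.

(** The Riesz-Kantorovich formula: at x >= 0 the positive part of f is the
    supremum of f over the order interval [0, x]. Additivity of this supremum
    is the Riesz decomposition property. The last clause records the bound
    that this formula gives on the values of the positive part. *)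
Lemma dual_pos_part : exists K : R, forall f : dual V, exists p : dual V,
  [/\ dual_cone P p, dual_cone P (p - f), `|p| <= K * `|f| &
      forall x M, P x -> (forall w, P w -> P (x - w) -> f w <= M) -> p x <= M].
Proof.
have [K K0 HK] := lcone_sup_ge0 HP.
have [N HN] := lcone_norm HP.
exists (`|N| * K + `|N| * (K + 1)) => f.
pose A x := [set w | P w /\ P (x - w)].
pose F x := sup [set f w | w in A x].
have A0 x : P x -> A x 0.
  by move=> Px; split; [exact: lcone0 HP|rewrite subr0].
have Aub x w : A x w -> f w <= `|f| * `|N| * `|x|.
  move=> [Pw Pxw]; rewrite (le_trans (ler_dual f w))// -mulrA ler_wpM2l//.
  by rewrite (le_trans (HN _ _ Pw Pxw))// ler_wpM2r// ler_norm.
have Ahs x : P x -> has_sup [set f w | w in A x].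
  move=> Px; split; first by exists (f 0); exists 0 => //; exact: A0.
  by exists (`|f| * `|N| * `|x|) => _ [w Aw <-]; exact: Aub.
have FA x w : P x -> A x w -> f w <= F x.
  by move=> Px Aw; apply: ub_le_sup; [exact: (Ahs x Px).2|exists w].
have Fle x M : P x -> (forall w, A x w -> f w <= M) -> F x <= M.
  move=> Px fM; apply: ge_sup; first exact: (Ahs x Px).1.
  by move=> _ [w Aw <-]; exact: fM.
have F0 x : P x -> 0 <= F x.
  by move=> Px; rewrite -(dual0 f); apply: FA => //; exact: A0.
have Fub x : P x -> F x <= `|f| * `|N| * `|x|.
  by move=> Px; apply: Fle => // w; exact: Aub.
have [p pF] : exists p : dual V, forall x, P x -> p x = F x.
  apply: (@cone_extension _ _ HP _ (`|f| * `|N|)) => [x y Px Py|a x a0 Px|x Px].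
  - have Pxy : P (x + y) by exact: (lconeD HP).
    apply/le_anti/andP; split.
      apply: Fle => // z [Pz Pz'].
      have [w [Pw Pxw] [Pzw Pyzw]] := lcone_decomp Px Py Pz Pz'.
      by rewrite -(subrKC w z) dualD lerD// FA.
    rewrite -lerBrDr; apply: (Fle) => // w [Pw Pxw].
    rewrite lerBrDr addrC -lerBrDr; apply: Fle => // z [Pz Pyz].
    rewrite lerBrDr -dualD; apply: FA => //; split; first exact: (lconeD HP).
    by rewrite (addrC z) opprD addrACA; exact: (lconeD HP).
  - have Pax : P (a *: x) by apply: (lconeZ HP) => //; exact: ltW.
    rewrite -ler_pdivlMl//; apply: Fle => // w [Pw Pxw].
    rewrite ler_pdivlMl// -dualZ; apply: FA => //; split.
      by apply: (lconeZ HP) => //; exact: ltW.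
    by rewrite -scalerBr; apply: (lconeZ HP) => //; exact: ltW.
  - by rewrite ger0_norm ?F0// Fub.
exists p; split.
- by move=> x Px; rewrite pF// F0.
- move=> x Px; rewrite dualEB subr_ge0 pF//; apply: FA => //; split => //.
  by rewrite subrr; exact: lcone0 HP.
- apply: dual_norm_le => x x1.
  have [q [Pq Px Kq _]] := HK x.
  have -> : p x = p q - p (q - x) by rewrite dualB subKr.
  rewrite (le_trans (ler_normB _ _))// !pF// (ger0_norm (F0 _ Pq)) (ger0_norm
    (F0 _ Px)).
  rewrite mulrDl lerD//; apply: le_trans (Fub _ _) _ => //.
    rewrite [leRHS]mulrC mulrA ler_wpM2l ?mulr_ge0//.
    by rewrite (le_trans Kq) ?ler_piMr.
  rewrite [leRHS]mulrC mulrA ler_wpM2l ?mulr_ge0//.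
  by rewrite (le_trans (ler_normB _ _))// lerD// (le_trans Kq) ?ler_piMr.
- by move=> x M Px fM; rewrite pF//; apply: Fle => // w [Pw Pxw]; exact: fM.
Qed.

Lemma dual_cone_sup : exists K : R, forall f : dual V, exists p : dual V,
  [/\ dual_cone P p, dual_cone P (p - f), `|p| <= K * `|f| &
      forall q, dual_cone P q -> dual_cone P (q - f) -> dual_cone P (q - p)].
Proof.
have [K HK] := dual_pos_part; exists K => f.
have [p [p0 pf pK psup]] := HK f; exists p; split => // q q0 qf x Px.
rewrite dualEB subr_ge0; apply: psup => // w Pw Pxw.
have := qf _ Pw; rewrite dualEB subr_ge0 => /le_trans; apply.
by have := q0 _ Pxw; rewrite dualB subr_ge0.
Qed.

Lemma dual_lattice_cone : lattice_cone (@dual_cone V P).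
Proof.
split.
- by move=> f g f0 g0 x Px; rewrite dualED addr_ge0// ?f0// g0.
- by move=> a f a0 f0 x Px; rewrite dualEZ mulr_ge0// f0.
- exact: dual_cone_sup.
- exact: dual_cone_norm.
Qed.

End dual.
End lattice_cones.

(** * Positive functionals on a Banach lattice *)

Lemma lcone_diff {R : realType} (V : normedModType R) (P : V -> Prop) (v : V) :
  lattice_cone P -> exists p q, [/\ P p, P q & v = p - q].
Proof.
move=> HP; have [_ /(_ v)[p [Pp Pq _ _]]] := lcone_sup HP.
by exists p, (p - v); rewrite subKr.
Qed.

Lemma dual_cvg {R : realType} (V : normedModType R) (I : Type)
    (F : set_system I) (y : I -> V) (l : V) :
  y @ F --> l -> forall f : dual V, f (y n) @[n --> F] --> f l.
Proof. by move=> yl f; apply: cvg_comp yl _; exact: dual_continuous. Qed.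

Lemma dual_lim_le {R : realType} (V : normedModType R) (y : nat -> V) (l : V)
    (f : dual V) (c : R) :
  y @ \oo --> l -> (forall n, f (y n) <= c) -> f l <= c.
Proof.
move=> yl yc; have fl : f (y n) @[n --> \oo] --> f l by exact: dual_cvg.
rewrite -(cvg_lim _ fl)//; apply: limr_le; first by apply/cvg_ex; exists (f l).
by apply: nearW => n; exact: yc.
Qed.

Section order_and_functionals.
Context {R : realType} {E : banachLatticeType R}.
Implicit Types (x y z : E) (f : dual E).

Definition nneg x : Prop := 0 <= x.

Lemma nneg_lattice_cone : lattice_cone nneg.
Proof.
split.
- by move=> x y; exact: addE_ge0.
- by move=> a x; exact: scaleE_ge0.
- exists 1 => x; exists (pos x); rewrite /nneg mul1r ler_norm_pos leB0.
  split=> //; [exact: pos_ge0|exact: le_pos|].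
  by move=> q q0; rewrite !leB0 => xq; exact: pos_le.
- by exists 1 => x y x0; rewrite /nneg mul1r leB0; exact: ler_normE.
Qed.

Notation nneg_dual := (@dual_cone R E nneg).

Lemma nneg_dual_lattice_cone : lattice_cone nneg_dual.
Proof. exact: dual_lattice_cone nneg_lattice_cone. Qed.

Lemma ler_nneg_dual f x y : nneg_dual f -> x <= y -> f x <= f y.
Proof. by move=> f0; rewrite -leB0 => /f0; rewrite dualB subr_ge0. Qed.

Lemma nneg_dual_abs f x : nneg_dual f -> `|f x| <= f (modulus x).
Proof.
move=> f0; rewrite ler_norml lerNl -dualN.
by rewrite !ler_nneg_dual// ?le_modulus ?leN_modulus.
Qed.

Lemma norm_pos_le0 x : `|pos x| <= 0 -> x <= 0.
Proof.
by rewrite normr_le0 => /eqP x0; rewrite -[leRHS]x0 le_pos.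
Qed.

(** One functional bounded below by d on the whole sequence: apply Hahn-Banach
    to the infimum over n and t >= 0 of |(x + t z_n)^+| - t d. It is sublinear
    because the z_n decrease, it is at least -|x| because d <= |(z_n)^+|, and
    its value at - z_n is at most - d. *)
Lemma decreasing_support (z : nat -> E) (d : R) :
  (forall n, z n.+1 <= z n) -> (forall n, d <= `|pos (z n)|) ->
  exists f, [/\ nneg_dual f, forall x, f x <= `|pos x| &
    forall n, d <= f (z n)].
Proof.
move=> zS dz.
have zle m n : (m <= n)%N -> z n <= z m.
  rewrite -leN2; apply: (increasing_le (y := fun n => - z n)) => k.
  by rewrite leN2.
pose q (i : nat * R) x := `|pos (x + i.2 *: z i.1)| - i.2 * d.
pose A := [set i : nat * R | 0 <= i.2].
have qlb i x : A i -> - `|x| <= q i x.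
  case: i => n t; rewrite /A /q /= le_eqVlt => /predU1P[<-|t0].
    by rewrite scale0r addr0 mul0r subr0 (le_trans _ (normr_ge0 _))// oppr_le0.
  have : t * d <= t * `|pos (z n)| by rewrite ler_wpM2l// ltW.
  have -> : t * `|pos (z n)| = `|pos (t *: z n)|.
    by rewrite posZ// normrZ gtr0_norm.
  have : `|pos (t *: z n)| <= `|pos (x + t *: z n) + pos (- x)|.
    apply: ler_normE; first exact: pos_ge0.
    by rewrite (le_trans _ (posD _ _))// addrAC subrr add0r.
  have := ler_normD (pos (x + t *: z n)) (pos (- x)).
  by have := ler_norm_pos (- x); rewrite normrN; lra.
have sq : sublinear (fun x => inf [set q i x | i in A]).
  apply: (@sublinear_inf _ _ _ A q (fun x => - `|x|)) => //.
  - by exists (0%N, 0); rewrite /A /= lexx.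
  - move=> [m s] [n t] x y s0 t0; exists (maxn m n, s + t);
    first exact: addr_ge0.
    rewrite /q /=; apply: (@le_trans _ _ (`|pos (x + s *: z m) + pos (y + t *:
      z n)| - (s + t) * d)).
      rewrite lerD2r; apply: ler_normE; first exact: pos_ge0.
      rewrite (le_trans _ (posD _ _))// pos_homo// addrACA leD2l scalerDl.
      by rewrite leDD// leZ// zle ?leq_maxl ?leq_maxr.
    by have := ler_normD (pos (x + s *: z m)) (pos (y + t *: z n)); lra.
  - move=> [n t] a x t0 a0; exists (n, a * t);
    first by rewrite /A/= mulr_ge0// ltW.
    by rewrite /q /= -scalerA -scalerDr posZ// normrZ gtr0_norm// mulrBr mulrA.
have [f0 f0l f0le] := hahn_banach sq.
have f0q i x : A i -> f0 x <= q i x.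
  move=> Ai; apply: le_trans (f0le x) _; apply: ge_inf; last by exists i.
  by exists (- `|x|) => _ [j Aj <-]; exact: qlb.
have f0pos x : f0 x <= `|pos x|.
  have := f0q (0%N, 0) x (lexx 0).
  by rewrite /q /= scale0r addr0 mul0r subr0.
have f0N x : f0 (- x) = - f0 x.
  have f00 : f0 0 = 0 by have := f0l 1 0 0; rewrite scaler0 addr0; lra.
  by have := f0l (-1) x 0; rewrite addr0 f00 scaleN1r; lra.
have [f fE] : exists f : dual E, forall x, f x = f0 x.
  apply: (dual_of_linear (M := 1)) => // x; rewrite mul1r ler_norml lerNl -f0N.
  rewrite (le_trans (f0pos x) (ler_norm_pos x)) andbT.
  by rewrite (le_trans (f0pos _))// (le_trans (ler_norm_pos _))// normrN.
exists f; split => [x x0|x|n]; rewrite fE//.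
- rewrite -oppr_le0 -f0N (le_trans (f0pos _))// normr_le0; apply/eqP.
  by apply: join_r; rewrite -(leN2 0) opprK oppr0.
- have := f0q (n, 1) (- z n) ler01; rewrite f0N /q /= scale1r addNr mul1r.
  by rewrite ge0_pos// normr0; lra.
Qed.

Lemma norming_functional x :
  exists f, [/\ nneg_dual f, forall y, f y <= `|pos y| & `|pos x| <= f x].
Proof.
have [//|//|f [f0 fle fx]] := @decreasing_support (fun=> x) (`|pos x|).
by exists f; split => //; exact: (fx 0%N).
Qed.

Lemma nneg_dual_separates x : (forall f, nneg_dual f -> 0 <= f x) -> 0 <= x.
Proof.
move=> fx; rewrite -leN2 oppr0; apply: norm_pos_le0.
have [f [f0 _ /le_trans->//]] := norming_functional (- x).
by rewrite dualN oppr_le0 fx.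
Qed.

Lemma ge0_lim (y : nat -> E) (l : E) :
  (forall n, 0 <= y n) -> y @ \oo --> l -> 0 <= l.
Proof.
move=> y0 yl; apply: nneg_dual_separates => f f0.
rewrite -oppr_le0 -[leLHS]/((- f) l); apply: dual_lim_le yl _ => n.
by rewrite -[leLHS]/(- f (y n)) oppr_le0; exact: f0 (y0 n).
Qed.

Lemma le_lim (y : nat -> E) (l a : E) :
  (forall n, y n <= a) -> y @ \oo --> l -> l <= a.
Proof.
move=> ya yl; rewrite -leB0; apply: (@ge0_lim (fun n => a - y n)).
  by move=> n; rewrite leB0.
by apply: cvgB => //; exact: cvg_cst.
Qed.

Lemma increasing_le_lim (y : nat -> E) (l : E) n :
  (forall n, y n <= y n.+1) -> y @ \oo --> l -> y n <= l.
Proof.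
move=> yS yl; rewrite -leB0; apply: (@ge0_lim (fun m => y (m + n)%N - y n)).
  by move=> m; rewrite leB0 increasing_le// leq_addl.
by apply: cvgB; [rewrite cvg_shiftn|exact: cvg_cst].
Qed.

(** A Dini argument: if the norms of the decreasing vectors l - y_n stayed above
    e, some positive functional would stay above e on all of them. *)
Lemma increasing_weak_cvg (y : nat -> E) (l : E) : (forall n, y n <= y n.+1) ->
  (forall f, f (y n) @[n --> \oo] --> f l) -> y @ \oo --> l.
Proof.
move=> yS yl.
have yle n : y n <= l.
  rewrite -leB0; apply: nneg_dual_separates => f f0.
  rewrite dualB subr_ge0 -(cvg_lim _ (yl f))//.
  apply: nondecreasing_cvgn_le; last by apply/cvg_ex; exists (f l).
  by move=> i j ij; rewrite ler_nneg_dual// increasing_le.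
apply/cvgrPdist_lt => e e0.
have [[N Ne]|/forallNP small] := pselect (exists N, `|l - y N| < e).
  exists N => //= n /= Nn; apply: le_lt_trans Ne.
  by rewrite ler_normE ?leB0// leD2l leN2 increasing_le.
have [|n|f [f0 _ fe]] := @decreasing_support (fun n => l - y n) e.
- by move=> n; rewrite leD2l leN2.
- by rewrite ge0_pos ?leB0// leNgt; exact/negP/small.
have /cvgrPdist_lt/(_ e e0)[N _ /(_ N (leqnn N))] := yl f.
have := fe N; rewrite dualB => eN; rewrite ltNge => /negP[].
by rewrite (le_trans eN)// ler_norm.
Qed.

End order_and_functionals.

(** * Maximal elements by exhaustion *)

Section maximal_element.
Context {R : realType} {V : normedModType R}.

(** The bound on |x' - x| disposes of the case in which the elements above x are
    at unbounded distance. *)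
Lemma almost_furthest (D : V -> Prop) (le : V -> V -> Prop) (x : V) :
  D x -> le x x -> exists x', [/\ D x', le x x' &
    `|x' - x| < 1 -> forall z, D z -> le x z -> `|z - x| <= 2 * `|x' - x|].
Proof.
move=> Dx lexx_.
have [[z [Dz xz z1]]|far] := pselect (exists z, [/\ D z, le x z & 1 <= `|z -
  x|]).
  by exists z; split => //; rewrite ltNge z1.
pose S := [set `|z - x| | z in [set z | D z /\ le x z]].
have S0 : S !=set0 by exists `|x - x|; exists x.
have Sub : has_ubound S.
  exists 1 => _ [z [Dz xz] <-]; rewrite leNgt; apply/negP => z1; apply: far.
  by exists z; split => //; exact: ltW.
have Sle z : D z -> le x z -> `|z - x| <= sup S.
  by move=> Dz xz; apply: ub_le_sup => //; exists z.
have [s0|s0] := leP (sup S) 0.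
  exists x; split => // _ z Dz xz.
  by rewrite subrr normr0 mulr0 (le_trans (Sle _ Dz xz)).
have s20 : 0 < sup S / 2 by rewrite divr_gt0.
have [_ [x' [Dx' xx'] <-] sx'] := sup_adherent s20 (conj S0 Sub).
exists x'; split => // _ z Dz xz; apply: le_trans (Sle _ Dz xz) _.
by move: sx'; lra.
Qed.

(** Move repeatedly to an element above the current one that is at least half as
    far from it as any other. When the sequence converges its steps tend to 0,
    so nothing is left strictly above the limit. *)
Theorem maximal_element (D : V -> Prop) (le : V -> V -> Prop) (a : V) :
  D a -> (forall x, le x x) -> (forall x y z, le x y -> le y z -> le x z) ->
  (forall y : nat -> V, (forall n, D (y n)) -> (forall n, le (y n) (y n.+1)) ->
     exists l, [/\ D l, y @ \oo --> l & forall n, le (y n) l]) ->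
  exists2 m, D m & forall z, D z -> le m z -> z = m.
Proof.
move=> Da le_refl le_trans seq_lim.
have /choice[X XP] : forall x, exists x', D x -> [/\ D x', le x x' &
    `|x' - x| < 1 -> forall z, D z -> le x z -> `|z - x| <= 2 * `|x' - x|].
  move=> x; have [Dx|nDx] := pselect (D x); last by exists x.
  by have [x' ?] := almost_furthest Dx (le_refl x); exists x'.
pose y n := iter n X a.
have Dy n : D (y n) by elim: n => // n /XP[].
have yS n : le (y n) (y n.+1) by have [] := XP _ (Dy n).
have [l [Dl yl lel]] := seq_lim y Dy yS.
exists l => // z Dz lz.
have yS0 : y n.+1 - y n @[n --> \oo] --> (0 : V).
  rewrite -(subrr l); apply: cvgB => //.
  by rewrite (@cvg_shiftS _ y).
suff yz : y @ \oo --> z by apply: cvg_unique yz yl.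
apply/cvgrPdist_lt => e e0.
have e20 : 0 < Num.min 1 (e / 2) by rewrite lt_min ltr01 divr_gt0.
move/cvgrPdist_lt : yS0 => /(_ _ e20); apply: filterS => n.
rewrite sub0r normrN lt_min => /andP[y1 ye].
have [_ _ /(_ y1 z Dz (le_trans _ _ _ (lel n) lz))] := XP _ (Dy n).
by move=> /= zy; move: ye zy; rewrite /y /=; lra.
Qed.

End maximal_element.

(** * Disjoint sequences and the unit ball *)

Section disjoint_sequences.
Context {R : realType} {E : banachLatticeType R}.
Implicit Types (x y z u w : E) (f : dual E).
Notation nneg_dual := (@dual_cone R E nneg).

Definition disjoint_sequences_null : Prop :=
  forall f (w : nat -> E) (M d : R), nneg_dual f -> (forall n, 0 <= w n) ->
    (forall m n, (m < n)%N -> (w m `&` w n)%O = 0) -> (forall n, `|w n| <= M) ->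
    0 < d -> exists n, f (w n) < d.

(** For the seminorm f(|x|) the unit ball lies, up to e, in an order interval.
    Having this for all f amounts to order continuity of the dual norm. *)
Definition ball_almost_order_bounded : Prop :=
  forall f (e : R), nneg_dual f -> 0 < e -> exists2 u, 0 <= u &
    forall x, 0 <= x -> `|x| <= 1 -> f (pos (x - u)) <= e.

Lemma geometric_upper_bound (x : nat -> E) : (forall n, 0 <= x n) ->
  (forall n, `|x n| <= 1) -> exists2 y, 0 <= y & forall n, 2^-1 ^+ n *:
    x n <= y.
Proof.
move=> x0 x1; pose s := series (fun n => 2^-1 ^+ n *: x n).
have t0 n : 0 <= 2^-1 ^+ n *: x n by rewrite scaleE_ge0// exprn_ge0.
have sS n : s n <= s n.+1.
  by rewrite /s /series /= big_nat_recr//= -[leLHS]addr0 leD2l.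
have /cvg_ex[y sy] : cvgn s.
  apply: normed_cvg.
  apply: (series_le_cvg (v_ := geometric 1 2^-1)) => [n|n|n|].
  - by rewrite normr_ge0.
  - by rewrite /geometric /= mul1r exprn_ge0.
  - by rewrite /geometric /= mul1r normrZ ger0_norm ?exprn_ge0// ler_piMr//
    exprn_ge0.
  - by apply: is_cvg_geometric_series; rewrite ger0_norm ?invr_ge0// invf_lt1//
    ltr1n.
have sy' n := increasing_le_lim n sS sy.
have s0 n : 0 <= s n.
  by have := @increasing_le _ _ s 0 n sS (leq0n _);
    rewrite /s /series /= big_geq.
exists y => [|n]; first exact: le_trans (s0 0%N) (sy' 0%N).
apply: le_trans (sy' n.+1); rewrite /s /series /= big_nat_recr//=.
by rewrite -[leLHS]add0r leD2r; exact: s0.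
Qed.

(** The form in which disjointness is met below: one of the two parts of a
    vector is scaled down. *)
Lemma pos_disjoint a x y : 0 < a -> a <= 1 -> (pos x `&` a *: pos (- x))%O = 0.
Proof.
move=> a0 a1; apply/le_anti/andP; split.
  rewrite -[leRHS](pos_meet_posN x) lexI leIl (le_trans (leIr _ _))//.
  by rewrite -[leRHS]scale1r scaleE_le// pos_ge0.
by rewrite meet_ge0 ?pos_ge0// scaleE_ge0 ?pos_ge0// ltW.
Qed.

(** If no u works for f and e, choose x_n in the ball with
    f((x_n - 4^n S_n)^+) > e, where S_n is the sum of the previous choices, and
    let y dominate all 2^-n x_n. The vectors
    W_n = (x_n - 4^n S_n - 2^-n y)^+ are disjoint: for m < n, W_n lies below
    (x_n - 4^n x_m)^+ and W_m below 4^-n (x_n - 4^n x_m)^-. Subtracting 2^-n y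
    costs only 2^-n f(y), so f(W_n) stays above e / 2 for large n. *)
Theorem disjoint_null_almost_order_bounded :
  disjoint_sequences_null -> ball_almost_order_bounded.
Proof.
move=> disj f e f0 e0; apply: contrapT => /forall2NP nou.
have /choice[X XP] : forall u, exists x, 0 <= u ->
    [/\ 0 <= x, `|x| <= 1 & e < f (pos (x - u))].
  move=> u; have [u0|nu0] := boolP (0 <= u); last by exists 0.
  have [//|/existsNP[x /not_implyP[x0 /not_implyP[x1 /negP]]]] := nou u.
  by rewrite -ltNge => xe; exists x.
pose S := fix S n := if n is m.+1 then S m + X (4 ^+ m *: S m) else 0.
pose x n := X (4 ^+ n *: S n).
have S0 n : 0 <= S n.
  elim: n => [|n IH]; first exact: lexx.
  by rewrite /= addE_ge0//; have [] := XP (4 ^+ n *: S n);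
    rewrite // scaleE_ge0// exprn_ge0.
have u0 n : 0 <= 4 ^+ n *: S n by rewrite scaleE_ge0// exprn_ge0.
have x0 n : 0 <= x n by have [] := XP _ (u0 n).
have x1 n : `|x n| <= 1 by have [] := XP _ (u0 n).
have xe n : e < f (pos (x n - 4 ^+ n *: S n)) by have [] := XP _ (u0 n).
have xS m n : (m < n)%N -> x m <= S n.
  move=> mn; apply: le_trans (increasing_le (y := S) _ mn).
    by rewrite /= -[leLHS]add0r leD2r.
  by move=> k; rewrite /= -[leLHS]addr0 leD2l; exact: x0.
have [y y0 xy] := geometric_upper_bound x0 x1.
pose W n := pos (x n - 4 ^+ n *: S n - 2^-1 ^+ n *: y).
have W0 n : 0 <= W n by exact: pos_ge0.
have Wdisj m n : (m < n)%N -> (W m `&` W n)%O = 0.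
  move=> mn; apply/le_anti; rewrite meet_ge0// andbT.
  (* As m < n, the coefficient 2^-(m + n) of x_n inside 2^-m y is at least
     4^-n. *)
  have c0 : (0 : R) < 4 ^- n by rewrite invr_gt0 exprn_gt0.
  have Wm : W m <= 4 ^- n *: pos (- (x n - 4 ^+ n *: x m)).
    rewrite -posZ// pos_homo// opprB scalerBr scalerA mulVf ?expf_neq0//
      scale1r.
    rewrite leDD//.
      by rewrite -[leRHS]subr0 leD2l leN2.
    rewrite leN2; apply: (@le_trans _ _ (2^-1 ^+ m *: (2^-1 ^+ n *: x n))).
      rewrite scalerA scaleE_le// -exprD -exprVn.
      have -> : (4^-1 : R) = 2^-1 ^+ 2 by rewrite exprVn -natrX.
      rewrite -exprM ler_wiXn2l ?invr_ge0 ?invf_le1 ?ler1n//.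
      by rewrite mul2n -addnn leq_add2r ltnW.
    by rewrite leZ// exprn_ge0.
  have Wn : W n <= pos (x n - 4 ^+ n *: x m).
    rewrite pos_homo// (le_trans (y := x n - 4 ^+ n *: S n))//.
      by rewrite -[leRHS]subr0 leD2l leN2 scaleE_ge0// exprn_ge0.
    by rewrite leD2l leN2 leZ ?xS// exprn_ge0.
  have c1 : (4 ^- n : R) <= 1 by rewrite invf_le1 ?exprn_gt0// exprn_ege1//
    ler1n.
  rewrite -(pos_disjoint (x n - 4 ^+ n *: x m) 0 c0 c1) lexI.
  by rewrite (le_trans (leIr _ _) Wn) (le_trans (leIl _ _) Wm).
have fW n : e - 2^-1 ^+ n * f y <= f (W n).
  have : pos (x n - 4 ^+ n *: S n) <= W n + 2^-1 ^+ n *: y.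
    rewrite -{1}(subrK (2^-1 ^+ n *: y) (x n - _)) (le_trans (posD _ _))//.
    by rewrite leD2l ge0_pos// scaleE_ge0// exprn_ge0.
  by move=> /(ler_nneg_dual f0); rewrite dualD dualZ; have := xe n; lra.
have W1 n : `|W n| <= 1.
  apply: le_trans (x1 n); rewrite ler_normE// pos_le//.
  rewrite -[leRHS]subr0 -addrA leD2l -opprD leN2 addE_ge0//.
  by rewrite scaleE_ge0// exprn_ge0.
have [N Ne] : exists N, forall n, (N <= n)%N -> 2^-1 ^+ n * f y < e / 2.
  have : 2^-1 ^+ n * f y @[n --> \oo] --> (0 : R).
    rewrite -(mul0r (f y)); apply: cvgM; last exact: cvg_cst.
    by apply: cvg_expr; rewrite ger0_norm ?invr_ge0// invf_lt1// ltr1n.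
  have e20 : 0 < e / 2 by rewrite divr_gt0.
  move=> /cvgrPdist_lt/(_ _ e20)[N _ HN]; exists N => n Nn.
  by have := HN n Nn; rewrite /= sub0r normrN => /(le_lt_trans (ler_norm _)).
have e20 : 0 < e / 2 by rewrite divr_gt0.
have [n] := disj f (fun n => W (n + N)%N) 1 (e / 2) f0 (fun=> W0 _)
  (fun m n mn => Wdisj _ _ (etrans (ltn_add2r _ _ _) mn)) (fun=> W1 _) e20.
by have := fW (n + N)%N; have := Ne (n + N)%N (leq_addl _ _); lra.
Qed.

End disjoint_sequences.

(** * Monotone limits and decompositions in the dual *)

Section representation.
Context {R : realType} {E : banachLatticeType R}.
Implicit Types (x y z u v w : E) (f g h : dual E).
Notation nneg_dual := (@dual_cone R E nneg).

(** Banach lattices with this property are called KB-spaces. *)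
Definition monotone_complete : Prop :=
  forall (y : nat -> E) (M : R), (forall n, y n <= y n.+1) ->
    (forall n, `|y n| <= M) -> exists l : E, y @ \oo --> l.

Lemma nneg_dualD f g : nneg_dual f -> nneg_dual g -> nneg_dual (f + g).
Proof. exact: (lconeD nneg_dual_lattice_cone). Qed.

Lemma nneg_dualZ (a : R) f : 0 <= a -> nneg_dual f -> nneg_dual (a *: f).
Proof. exact: (lconeZ nneg_dual_lattice_cone). Qed.

Lemma nneg_dual_trans f g h :
  nneg_dual (g - f) -> nneg_dual (h - g) -> nneg_dual (h - f).
Proof. by move=> fg gh; rewrite -(subrK g h) -addrA; exact: nneg_dualD. Qed.

(** On the order interval [0, f] of the dual, the norm is controlled by the
    evaluation at a single u; this makes [0, f] monotone complete. *)
Lemma dual_norm_le_almost f (e : R) : ball_almost_order_bounded (E := E) ->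
  nneg_dual f -> 0 < e -> exists2 u, 0 <= u &
    forall g, nneg_dual g -> nneg_dual (f - g) -> `|g| <= g u + e.
Proof.
move=> aob f0 e0; have [u u0 fu] := aob f e f0 e0.
exists u => // g g0 gf; apply: dual_norm_le => x x1.
apply: le_trans (nneg_dual_abs _ g0) _.
have xu : modulus x <= u + pos (modulus x - u).
  by rewrite addrC -leBlDr le_pos.
apply: le_trans (ler_nneg_dual g0 xu) _; rewrite dualD lerD2l.
apply: (@le_trans _ _ (f (pos (modulus x - u)))).
  by rewrite -subr_ge0 -dualEB; apply: gf; exact: pos_ge0.
by rewrite fu ?modulus_ge0// norm_modulus.
Qed.

(** The pointwise limit g exists by monotonicity, and convergence at the u of
    the previous lemma makes g - h_n small in norm. *)
Lemma dual_interval_increasing_cvg f (h : nat -> dual E) :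
  ball_almost_order_bounded (E := E) -> nneg_dual f ->
  (forall n, nneg_dual (h n)) -> (forall n, nneg_dual (f - h n)) ->
  (forall n, nneg_dual (h n.+1 - h n)) ->
  exists g, [/\ nneg_dual g, nneg_dual (f - g), h @ \oo --> g &
                forall n, nneg_dual (g - h n)].
Proof.
move=> aob f0 h0 hf hS.
have hle x m n : 0 <= x -> (m <= n)%N -> h m x <= h n x.
  move=> x0; elim: n => [|n IH]; first by rewrite leqn0 => /eqP ->.
  rewrite leq_eqVlt => /predU1P[->//|]; rewrite ltnS => /IH/le_trans; apply.
  by rewrite -subr_ge0; exact: hS.
have hub x n : 0 <= x -> h n x <= f x by rewrite -subr_ge0; exact: hf.
have hpos x : 0 <= x -> cvgn (fun n => h n x).
  move=> x0; apply: nondecreasing_is_cvgn => [m n|]; first exact: hle.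
  by exists (f x) => _ [n _ <-]; exact: hub.
have hx x : cvgn (fun n => h n x).
  have -> : (fun n => h n x) = (fun n => h n (pos x)) \- (fun n => h n (pos (-
    x))).
    by apply/funext => n /=; rewrite -dualB -pos_decomp.
  by apply: is_cvgB; apply: hpos; exact: pos_ge0.
pose F x : R := lim (h n x @[n --> \oo]).
have Fpos x : 0 <= x -> 0 <= F x.
  by move=> x0; apply: limr_ge => //; apply: nearW => n; exact: h0.
have Ff x : 0 <= x -> F x <= f x.
  by move=> x0; apply: limr_le => //; apply: nearW => n; exact: hub.
have hF x n : 0 <= x -> h n x <= F x.
  by move=> x0; apply: nondecreasing_cvgn_le => // i j; exact: hle.
have Flin (a : R) x y : F (a *: x + y) = a * F x + F y.
  apply: cvg_lim => //.
  under eq_fun do rewrite dualD dualZ.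
  by apply: cvgD; [apply: cvgM; [exact: cvg_cst|exact: hx]|exact: hx].
have FN x : F (- x) = - F x.
  have F0 : F 0 = 0 by have := Flin 1 0 0; rewrite scaler0 addr0; lra.
  by have := Flin (-1) x 0; rewrite addr0 F0 scaleN1r; lra.
have FD x y : F (x + y) = F x + F y by have := Flin 1 x y;
  rewrite scale1r mul1r.
have Fmono x y : x <= y -> F x <= F y.
  by rewrite -leB0 => /Fpos; rewrite FD FN subr_ge0.
have [g gF] : exists g : dual E, forall x, g x = F x.
  apply: (@dual_of_linear _ _ _ `|f|) => // x.
  rewrite -(norm_modulus x) (le_trans _ (ler_dual f (modulus x)))//.
  rewrite (le_trans _ (Ff _ (modulus_ge0 x)))// ler_norml lerNl -FN.
  by rewrite !Fmono ?le_modulus// leN_modulus.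
have gh n : nneg_dual (g - h n).
  by move=> x x0; rewrite dualEB subr_ge0 gF hF.
have gf : nneg_dual (f - g) by move=> x x0; rewrite dualEB subr_ge0 gF Ff.
exists g; split => //; first by move=> x x0; rewrite gF Fpos.
apply/cvgrPdist_lt => e e0.
have e20 : 0 < e / 2 by rewrite divr_gt0.
have [u u0 fu] := dual_norm_le_almost aob f0 e20.
have := hx u; move/cvgrPdist_lt => /(_ _ e20); apply: filterS => n /= hn.
have : `|g - h n| <= (g - h n) u + e / 2.
  apply: fu => //; apply: (@nneg_dual_trans _ (f - h n)); last by rewrite subKr.
  by rewrite opprB addrA subrK.
have := ler_norm (lim (h k u @[k --> \oo]) - h n u).
by rewrite dualEB gF /F; move: hn; lra.
Qed.

(** Hahn decomposition: remove from f a maximal h in [0, f] with T h <= 0. *)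
Lemma dual_hahn_part (T : dual (dual E)) f :
  ball_almost_order_bounded (E := E) -> nneg_dual f ->
  exists g0, [/\ nneg_dual g0, nneg_dual (f - g0), T f <= T g0 &
    forall g, nneg_dual g -> nneg_dual (g0 - g) -> 0 <= T g].
Proof.
move=> aob f0.
pose D h := [/\ nneg_dual h, nneg_dual (f - h) & T h <= 0].
have [|||h hd hh|h [h0 hf Th] hmax] :=
  @maximal_element _ _ D (fun h h' => nneg_dual (h' - h)) 0.
- by split; rewrite ?subr0// ?dual0//; exact: lcone0 nneg_dual_lattice_cone.
- by move=> h; rewrite subrr; exact: lcone0 nneg_dual_lattice_cone.
- by move=> ? ? ?; exact: nneg_dual_trans.
- have [|||g [g0 gf hg hleg]] := @dual_interval_increasing_cvg f h aob f0.
  + by move=> n; have [] := hd n.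
  + by move=> n; have [] := hd n.
  + exact: hh.
  exists g; split => //; split => //.
  by apply: dual_lim_le hg _ => n; have [] := hd n.
exists (f - h); split => //; [by rewrite subKr|by rewrite dualB; lra|].
move=> g g0 gfh; rewrite leNgt; apply/negP => Tg.
have /(congr1 (fun k => T (k - h))) : h + g = h.
  apply: hmax; last by rewrite addrAC subrr add0r.
  split; [exact: nneg_dualD|by rewrite opprD addrA|rewrite dualD; lra].
by rewrite addrAC !subrr add0r dual0; lra.
Qed.

(** Remove from u a maximal v in [0, u] with g0 v = 0; what is left is the part
    of u on which g0 is strictly positive. *)
Lemma carrier_part (g0 : dual E) u : monotone_complete -> nneg_dual g0 ->
  0 <= u ->
  exists v, [/\ 0 <= v, v <= u, g0 v = g0 u &
    forall w, 0 <= w -> w <= v -> g0 w = 0 -> w = 0].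
Proof.
move=> mono g00 u0.
pose D v := [/\ 0 <= v, v <= u & g0 v = 0].
have [|||y yd yS|v [v0 vu gv] vmax] := @maximal_element _ _ D (fun x y => x <=
  y) 0.
- by split; rewrite ?dual0 ?lexx.
- by move=> x.
- by move=> x y z; exact: le_trans.
- have [|l yl] := mono y `|u| yS.
    by move=> n; have [yn0 yu _] := yd n; rewrite ler_normE.
  exists l; split=> //; last by move=> n; exact: increasing_le_lim.
  have l0 : 0 <= l by apply: ge0_lim yl => n; have [] := yd n.
  split=> //; first by apply: le_lim yl => n; have [] := yd n.
  apply/le_anti; rewrite g00 ?andbT//.
  by apply: dual_lim_le yl _ => n; have [_ _ ->] := yd n.
exists (u - v); split.
- by rewrite leB0.
- by rewrite -[leRHS]subr0 leD2l leN2.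
- by rewrite dualB gv subr0.
- move=> w w0 wuv gw; have : v + w = v.
    apply: vmax; last by rewrite -[leLHS]addr0 leD2l.
    split; [exact: addE_ge0|by rewrite addrC -(subrK v u) leD2r|].
    by rewrite dualD gv gw addr0.
  by move=> /eqP; rewrite -subr_eq0 addrAC subrr add0r => /eqP.
Qed.

(** Absolute continuity of g with respect to g0 on [0, u]. If it failed there
    would be v_k in [0, u] with g(v_k) >= d and g0(v_k) of order 2^-k; by the
    Borel-Cantelli argument their upper limit w satisfies g0(w) = 0 and
    g(w) >= d, which strict positivity of g0 excludes. *)
Lemma strictly_positive_dominates (g0 g : dual E) u (d : R) :
  monotone_complete -> nneg_dual g0 -> nneg_dual g -> 0 <= u -> 0 < d ->
  (forall w, 0 <= w -> w <= u -> g0 w = 0 -> w = 0) ->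
  exists2 C : R, 0 < C & forall v, 0 <= v -> v <= u -> g v <= d + C * g0 v.
Proof.
move=> mono g00 gge0 u0 d0 strict; apply: contrapT => /forall2NP noC.
have /choice[v vP] : forall k : nat, exists v,
    [/\ 0 <= v, v <= u & d + 2 ^+ k * g0 v < g v].
  move=> k; have [|] := noC (2 ^+ k); first by rewrite exprn_gt0.
  move=> /existsNP[v /not_implyP[v0 /not_implyP[vu /negP]]].
  by rewrite -ltNge => gv; exists v.
have v0 k : 0 <= v k by have [] := vP k.
have vu k : v k <= u by have [] := vP k.
have g0v0 k : 0 <= g0 (v k) by exact: g00 (v0 k).
have gv k : d <= g (v k).
  have [_ _ /ltW] := vP k; apply: le_trans.
  by rewrite lerDl mulr_ge0// exprn_ge0.
pose c := g u.
have g0v k : g0 (v k) <= c * 2^-1 ^+ k.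
  have [_ _ gvk] := vP k; rewrite exprVn ler_pdivlMr ?exprn_gt0// mulrC.
  have := ler_nneg_dual gge0 (vu k); rewrite -/c.
  by move: gvk; lra.
have c0 : 0 <= c by exact: gge0 u0.
(* s k m is the supremum of v_k, ..., v_(k + m); its limit t k in m decreases
   with k to the upper limit of the v_k. *)
pose s := fix s (k m : nat) :=
  if m is m'.+1 then (s k m' `|` v (k + m'.+1)%N)%O else v k.
have sS k m : s k m <= s k m.+1 by exact: leUl.
have s0 k m : 0 <= s k m by exact: le_trans (v0 k)
  (@increasing_le _ _ (s k) 0%N m (sS k) (leq0n m)).
have su k m : s k m <= u by elim: m => [|m IH] /=; rewrite ?leUx ?IH vu.
have ss k m : s k.+1 m <= s k m.+1.
  elim: m => [|m IH]; first by rewrite /= addn1 leUr.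
  rewrite [leLHS]/= [leRHS]/= addSnnS leUx leUr andbT.
  exact: le_trans IH (leUl _ _).
have g0s k m : g0 (s k m) <= c * (2 * 2^-1 ^+ k - 2^-1 ^+ (k + m)).
  elim: m => [|m IH]; first by rewrite addn0 /=; have := g0v k; lra.
  have : s k m.+1 <= s k m + v (k + m.+1)%N.
    rewrite leUx; apply/andP; split; first by rewrite -[leLHS]addr0 leD2l.
    by rewrite -[leLHS]add0r leD2r.
  move=> /(ler_nneg_dual g00); rewrite dualD.
  have := g0v (k + m.+1)%N; rewrite addnS exprS.
  by move: IH; lra.
have /choice[t tP] : forall k, exists t : E, s k @ \oo --> t.
  by move=> k; apply: (mono _ `|u|) => // m; rewrite ler_normE.
have st k m : s k m <= t k by exact: increasing_le_lim.
have t0 k : 0 <= t k by exact: le_trans (s0 k 0%N) (st k 0%N).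
have tu k : t k <= u by apply: le_lim (tP k) => m.
have tS k : t k.+1 <= t k.
  by apply: le_lim (tP k.+1) => m; exact: le_trans (ss k m) (st k m.+1).
have g0t k : g0 (t k) <= c * (2 * 2^-1 ^+ k).
  apply: dual_lim_le (tP k) _ => m; apply: le_trans (g0s k m) _.
  rewrite ler_wpM2l//.
  by rewrite gerBl exprn_ge0.
have gt k : d <= g (t k) by apply: le_trans (gv k) _;
  apply: ler_nneg_dual => //; exact: (st k 0%N).
(* The upper limit is u - l, where l is the limit of the increasing u - t k. *)
have [|k|l tl] := mono (fun k => u - t k) `|u|.
- by move=> k; rewrite leD2l leN2.
- by rewrite ler_normE ?leB0// -[leRHS]subr0 leD2l leN2.
have lk k : u - t k <= l.
  by apply: (increasing_le_lim _ _ tl) => n; rewrite leD2l leN2.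
have l0 : 0 <= u - l.
  by rewrite leB0; apply: le_lim tl => k; rewrite -[leRHS]subr0 leD2l leN2.
have ul0 : u - l = 0.
  apply: strict => //.
    by rewrite -[leRHS]subr0 leD2l leN2 (le_trans _ (lk 0%N))// leB0.
  apply/le_anti; rewrite g00 ?andbT//.
  have cl : c * (2 * 2^-1 ^+ k) @[k --> \oo] --> (0 : R).
    rewrite -(mulr0 c); apply: cvgM; first exact: cvg_cst.
    rewrite -(mulr0 2); apply: cvgM; first exact: cvg_cst.
    by apply: cvg_expr; rewrite ger0_norm ?invr_ge0// invf_lt1// ltr1n.
  rewrite -(cvg_lim _ cl)//; apply: limr_ge; first by apply/cvg_ex; exists 0.
  apply: nearW => k; apply: le_trans (g0t k); apply: ler_nneg_dual => //.
  by rewrite leBlDr addrC -leBlDr.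
have : g l <= g u - d.
  by apply: dual_lim_le tl _ => k; rewrite dualB lerD2l lerN2.
by have := congr1 g ul0; rewrite dualB dual0; lra.
Qed.

End representation.

(** * Representation of the bidual *)

Section reflexivity.
Context {R : realType} {E : banachLatticeType R}.
Implicit Types (x y z u v w : E) (f g h : dual E).
Notation nneg_dual := (@dual_cone R E nneg).
Notation nneg_bidual := (@dual_cone R (dual E) nneg_dual).

(** Choose u with T bounded by |T| g(u), up to a quarter of T f, on [0, f], and
    t > 0 with t f(u) <= T f / 2. The Hahn decomposition of T - t u below f
    gives g0 such that t g(u) <= T g whenever 0 <= g <= g0, with g0(u) > 0. Then
    z = t v, where v is the part of u carried by g0. For arbitrary g >= 0 the
    inequality g(z) <= T g is obtained for the minimum of g and N g0, which
    differs little from g at v when N is large, by domination. *)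
Lemma minorant (T : dual (dual E)) f : monotone_complete (E := E) ->
  ball_almost_order_bounded (E := E) -> nneg_bidual T -> nneg_dual f ->
    0 < T f ->
  exists z, [/\ 0 <= z, z != 0 & forall g, nneg_dual g -> g z <= T g].
Proof.
move=> mono aob T0 f0 Tf.
pose C := `|T| + 1.
have C0 : 0 < C by rewrite ltr_wpDl.
pose e := T f / (4 * C).
have e0 : 0 < e by rewrite divr_gt0// mulr_gt0.
have Ce : C * e = T f / 4 by rewrite /e; field; rewrite gt_eqF.
have [u u0 fu] := dual_norm_le_almost aob f0 e0.
have fu0 : 0 <= f u by exact: f0.
have fu1 : 0 < f u + 1 by rewrite ltr_wpDl.
pose t := T f / (2 * (f u + 1)).
have t0 : 0 < t by rewrite divr_gt0// mulr_gt0.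
have tfu : t * (f u + 1) = T f / 2 by rewrite /t; field; rewrite gt_eqF.
pose Q := T - t *: bidual_embed u.
have QE g : Q g = T g - t * g u by [].
have [g0 [g00 fg0 Qg0 Qpos]] := dual_hahn_part Q aob f0.
have [v [v0 vu g0v strict]] := carrier_part mono g00 u0.
exists (t *: v); split.
- by rewrite scaleE_ge0// ltW.
(* If v = 0 then g0 u = 0, so T g0 <= T f / 4 although T g0 >= T f / 2. *)
- rewrite scaler_eq0 gt_eqF//=; apply/eqP => vE.
  move: g0v; rewrite vE dual0 => /esym g0u.
  have := fu _ g00 fg0; rewrite g0u add0r => g0e.
  have : T g0 <= C * e.
    apply: le_trans (ler_dual T g0) _.
    by rewrite ler_pM// lerDl.
  by move: Qg0; rewrite !QE g0u mulr0 Ce; move: tfu; lra.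
move=> g gge0; rewrite dualZ; apply/ler_addgt0Pr => d d0.
have dt0 : 0 < d / t by rewrite divr_gt0.
have [N N0 gN] := strictly_positive_dominates mono g00 gge0 v0 dt0 strict.
have [_ /(_ (g - N *: g0))[p [p0 pg _ psup]]] :=
  dual_pos_part (@nneg_lattice_cone R E).
have pv : p v <= d / t.
  apply: psup => // w w0; rewrite /nneg leB0 => wv.
  by rewrite dualEB dualEZ; have := gN w w0 wv; lra.
(* p is (g - N g0)^+, hence k is the minimum of g and N g0. *)
pose k := g - p.
have k0 : nneg_dual k.
  move=> x x0; rewrite dualEB subr_ge0; apply: psup => // w w0;
    rewrite /nneg leB0 => wx.
  rewrite dualEB dualEZ.
  have := g00 _ w0; have := ler_nneg_dual gge0 wx; nra.
have Nk : nneg_dual (g0 - N^-1 *: k).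
  move=> x x0; have := pg x x0; rewrite !dualEB !dualEZ !dualEB subr_ge0 => pgx.
  by rewrite subr_ge0 ler_pdivrMl//; lra.
have Qk : 0 <= Q k.
  have := Qpos (N^-1 *: k); rewrite dualZ pmulr_rge0 ?invr_gt0//; apply => //.
  by apply: nneg_dualZ => //; rewrite invr_ge0 ltW.
have Tk : T k <= T g by rewrite /k dualB gerBl T0.
have kvu := ler_nneg_dual k0 vu.
have tk : t * k v <= t * k u by rewrite ler_wpM2l// ltW.
have tp : t * p v <= d.
  by rewrite mulrC -ler_pdivlMr.
by move: Qk tk; rewrite QE /k !dualEB; move: Tk; rewrite /k; lra.
Qed.

(** The x >= 0 lying below T are bounded in norm by |T| and closed under
    increasing limits, so there is a maximal one; by [minorant] nothing positive
    can be left between it and T. *)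
Lemma nneg_bidual_represented (T : dual (dual E)) :
  monotone_complete (E := E) ->
  ball_almost_order_bounded (E := E) -> nneg_bidual T ->
  exists x, T = bidual_embed x.
Proof.
move=> mono aob T0.
pose D y := 0 <= y /\ forall g, nneg_dual g -> g y <= T g.
have Dbound y : D y -> `|y| <= `|T|.
  move=> [y0 yT]; have [f [f0 fle fy]] := norming_functional y.
  rewrite -{1}(ge0_pos y0) (le_trans fy)// (le_trans (yT _ f0))//.
  rewrite (le_trans (ler_dual T f))// ler_piMr//.
  apply: dual_norm_le => x x1; rewrite ler_norml lerNl -dualN.
  rewrite (le_trans (fle x))//; last by rewrite (le_trans (ler_norm_pos x)).
  by rewrite (le_trans (fle _))// (le_trans (ler_norm_pos _))// normrN.
have [|||y yD yS|x [x0 xT] xmax] := @maximal_element _ _ D (fun x y => x <= y)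
  0.
- by split; rewrite ?lexx// => g g0; rewrite dual0 T0.
- by move=> x.
- by move=> x y z; exact: le_trans.
- have [|l yl] := mono y `|T| yS; first by move=> n; exact: Dbound.
  exists l; split=> //; last by move=> n; exact: increasing_le_lim.
  split; first by apply: ge0_lim yl => n; have [] := yD n.
  move=> g g0; apply: dual_lim_le yl _ => n.
  by have [_] := yD n; exact.
exists x; apply/dual_eqP => f.
have Q0 : nneg_bidual (T - bidual_embed x).
  by move=> g g0; rewrite dualEB subr_ge0 xT.
suff Qf g : nneg_dual g -> (T - bidual_embed x) g = 0.
  have [p [q [p0 q0 ->]]] := lcone_diff f nneg_dual_lattice_cone.
  have := Qf _ p0; have := Qf _ q0; rewrite !dualEB => /eqP + /eqP.
  by rewrite !subr_eq0 => /eqP qE /eqP pE; rewrite !dualB qE pE.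
move=> g0; apply/le_anti; rewrite (Q0 _ g0) andbT leNgt; apply/negP => Qg.
have [z [z0 /eqP znz zQ]] := minorant mono aob Q0 g0 Qg.
apply: znz; have : x + z = x.
  apply: xmax; last by rewrite -[leLHS]addr0 leD2l.
  split; first exact: addE_ge0.
  by move=> h h0; rewrite dualD; have := zQ h h0; rewrite dualEB /=; lra.
by move=> /eqP; rewrite -subr_eq0 addrAC subrr add0r => /eqP.
Qed.

Theorem monotone_complete_reflexive : monotone_complete (E := E) ->
  ball_almost_order_bounded (E := E) -> reflexive_space E.
Proof.
move=> mono aob; apply/seteqP; split => // T _.
have [p [q [p0 q0 ->]]] := lcone_diff T (dual_lattice_cone
  nneg_dual_lattice_cone).
have [x ->] := nneg_bidual_represented mono aob p0.
have [y ->] := nneg_bidual_represented mono aob q0.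
exists (x - y) => //; apply/dual_eqP => f; exact: dualB.
Qed.

End reflexivity.

(** * Disjoint sequences in reflexive lattices *)

Section reflexive_to_null.
Context {R : realType} {E : banachLatticeType R}.
Implicit Types (x y z u v w : E) (f g h : dual E).
Notation nneg_dual := (@dual_cone R E nneg).

(** The component of f carried by w: at y >= 0 it is the supremum of f(y /\ a w)
    over a >= 0. Additivity comes from
    (y /\ a w) + (y' /\ b w) <= (y + y') /\ (a + b) w. *)
Lemma band_component f w : nneg_dual f -> 0 <= w -> exists g : dual E,
  forall y, 0 <= y ->
    (forall a : R, 0 <= a -> f (y `&` a *: w)%O <= g y) /\
    (forall M, (forall a : R, 0 <= a -> f (y `&` a *: w)%O <= M) -> g y <= M).
Proof.
move=> f0 w0.
pose A y := [set f (y `&` a *: w)%O | a in [set a : R | 0 <= a]].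
have Aub y : has_ubound (A y).
  by exists (f y) => _ [a a0 <-]; rewrite ler_nneg_dual// leIl.
have A0 y : A y !=set0 by exists (f (y `&` 0 *: w)%O); exists 0;
  rewrite //= lexx.
have le_sup y a : 0 <= a -> f (y `&` a *: w)%O <= sup (A y).
  by move=> a0; apply: ub_le_sup => //; exists a.
have sup_le y M : (forall a, 0 <= a -> f (y `&` a *: w)%O <= M) ->
  sup (A y) <= M.
  by move=> fM; apply: ge_sup => // _ [a a0 <-]; exact: fM.
have [||y y0|g gE] := @cone_extension _ _ _ (@nneg_lattice_cone R E) (fun y =>
  sup (A y)) `|f|.
- move=> x y x0 y0; apply/le_anti/andP; split.
    apply: (sup_le) => a a0.
    apply: (@le_trans _ _ (f (x `&` a *: w)%O + f (y `&` a *: w)%O)).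
      by rewrite -dualD ler_nneg_dual// meetD_le// scaleE_ge0.
    by rewrite lerD// le_sup.
  rewrite -lerBrDr; apply: (sup_le) => a a0; rewrite lerBrDr addrC -lerBrDr.
  apply: (sup_le) => b b0; rewrite lerBrDr -dualD.
  apply: (le_trans _ (le_sup (x + y) (b + a) (addr_ge0 b0 a0))).
  by rewrite ler_nneg_dual// lexI scalerDl (addrC x) !leDD// ?leIl// leIr.
- move=> a y a0 y0; rewrite -ler_pdivlMl//; apply: (sup_le) => b b0.
  rewrite ler_pdivlMl// -dualZ meetZ// scalerA; apply: le_sup.
  by rewrite mulr_ge0// ltW.
- have : 0 <= sup (A y).
    by apply: (le_trans _ (le_sup y 0 (lexx 0))); apply: f0;
      rewrite /nneg scale0r meet_ge0.
  move=> /ger0_norm ->; apply: (le_trans _ (ler_dual f y));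
    apply: sup_le => a a0.
  by rewrite ler_nneg_dual// leIl.
exists g => y y0; rewrite gE//; split=> [a|M]; [exact: le_sup|exact: sup_le].
Qed.

Lemma bounded_ultra_cvg (I : Type) (G : set_system I) (h : I -> R) (M : R) :
  UltraFilter G -> (forall i, `|h i| <= M) -> cvg (h i @[i --> G]).
Proof.
move=> GU hM; pose H := h i @[i --> G].
have HU : UltraFilter H.
  split; first exact: fmap_proper_filter.
  move=> F PF HF; apply/seteqP; split => // A FA.
  have [//|GnA] := in_ultra_setVsetC (h @^-1` A) GU.
  have FnA : F (~` A) by apply: HF.
  have : F (A `&` ~` A) by exact: filterI.
  by rewrite setICr => /filter_not_empty.
have := @segment_compact R (- M) M; rewrite compact_ultra => /(_ H HU).
have HM : H `[- M, M]%classic.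
  by apply: nearW => i; rewrite /= in_itv/= -ler_norml hM.
by move=> /(_ HM)[p [_ Hp]]; apply/cvg_ex; exists p.
Qed.

(** Weak limits along an ultrafilter exist by reflexivity. The limit x of (w_n)
    would be disjoint from every w_n as far as f can see, and yet f(x) >= d. *)
Theorem reflexive_disjoint_null : reflexive_space E ->
  disjoint_sequences_null (E := E).
Proof.
move=> refl f w M d f0 w0 wdisj wM d0; apply: contrapT => /forallNP nofw.
have fw n : d <= f (w n) by rewrite leNgt; exact/negP/nofw.
have [G [GU ooG]] := ultraFilterLemma (eventually_filter).
have PG : ProperFilter G := @ultra_proper _ _ GU.
have M0 : 0 <= M by exact: le_trans (wM 0%N).
have gcvg g : cvg (g (w n) @[n --> G]).
  apply: (@bounded_ultra_cvg _ _ _ (`|g| * M)) => n.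
  by rewrite (le_trans (ler_dual_norm g (w n)))// ler_wpM2l ?dual_norm_ge0.
pose L g : R := lim (g (w n) @[n --> G]).
have [T TL] : exists T : dual (dual E), forall g, T g = L g.
  apply: (@dual_of_linear _ _ _ M) => [a g h|g].
    by apply: cvg_lim => //; apply: cvgD; [apply: cvgM;
      [exact: cvg_cst|exact: gcvg]|exact: gcvg].
  have gM n : `|g (w n)| <= M * `|g|.
    by rewrite mulrC (le_trans (ler_dual_norm g (w n)))//
      ler_wpM2l ?dual_norm_ge0.
  rewrite ler_norml; apply/andP; split; [apply: limr_ge|apply: limr_le] => //;
    by apply: nearW => n; have := gM n; rewrite ler_norml => /andP[].
have : [set: dual (dual E)] T by [].
rewrite -refl => -[x _ xT].
have gx g : g x = L g by rewrite -TL -xT.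
have x0 : 0 <= x.
  apply: nneg_dual_separates => g g0; rewrite gx; apply: limr_ge => //.
  by apply: nearW => n; exact: g0 (w0 n).
have fx : d <= f x.
  by rewrite gx; apply: limr_ge => //; apply: nearW => n; exact: fw.
have null g N : (forall n, (N <= n)%N -> g (w n) <= 0) -> g x <= 0.
  move=> gw; rewrite gx; apply: limr_le => //; apply: ooG.
  by exists N.
have meet0 m a y : 0 <= a -> 0 <= y -> f (w m `&` y)%O <= 0 ->
  f (w m `&` a *: y)%O <= 0.
  move=> a0 y0 fy; apply: (@le_trans _ _ ((a + 1) * f (w m `&` y)%O)).
    rewrite -dualZ ler_nneg_dual// meetZ ?ltr_wpDl// lexI.
    rewrite (le_trans (leIl _ _))//=.
      by rewrite (le_trans (leIr _ _))// scaleE_le// lerDl.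
    by rewrite -[leLHS]scale1r scaleE_le// lerDr.
  by rewrite mulr_ge0_le0// addr_ge0.
have fwx m : f (w m `&` x)%O <= 0.
  have [g gP] := band_component f0 (w0 m).
  have gle : g x <= 0.
    apply: (null g m.+1) => n mn; apply: (gP _ (w0 n)).2 => a a0.
    apply: meet0 => //; rewrite meetC wdisj//.
    by rewrite dual0.
  apply: le_trans gle; have := (gP _ x0).1 1 ler01.
  by rewrite scale1r meetC.
have [g gP] := band_component f0 x0.
have : g x <= 0.
  apply: (null g 0%N) => n _; apply: (gP _ (w0 n)).2 => a a0.
  exact: meet0.
by have := (gP _ x0).1 1 ler01; rewrite scale1r meetxx; lra.
Qed.

End reflexive_to_null.

(** * Unbounded convergence of nets and sequences *)

Section nets_and_sequences.
Context {R : realType} {E : banachLatticeType R}.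
Implicit Types (u v w : E) (f g h : dual E).
Notation nneg_dual := (@dual_cone R E nneg).
Notation nat_le := (fun m n : nat => (m <= n)%N).

Lemma bounded_rangeP (I : Type) (x : I -> E) :
  bounded_set (range x) <-> exists M, forall i, `|x i| <= M.
Proof.
split=> [[M [_ xM]]|[M xM]].
  by exists (M + 1) => i; apply: (xM (M + 1)); [rewrite ltrDl|exists i].
exists M; split; first exact: num_real.
by move=> N MN _ [i _ <-] /=; exact: le_trans (xM i) (ltW MN).
Qed.

Lemma directed_nat_le : directed nat_le.
Proof.
split=> [|i|i j k|i j]; [by constructor; exact: 0%N|by []|exact: leq_trans|].
by exists (maxn i j); rewrite leq_maxl leq_maxr.
Qed.

Lemma directed_prod_le (I : Type) (le : I -> I -> Prop) :
  directed le -> directed (prod_le le).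
Proof.
move=> [[i0] le_refl le_trans le_dir]; split.
- by constructor; exact: (i0, i0).
- by move=> [i j]; split; exact: le_refl.
- move=> [i1 i2] [j1 j2] [k1 k2] [/= a b] [/= c d].
  by split; [exact: le_trans a c|exact: le_trans b d].
- move=> [i1 i2] [j1 j2]; have [k1 [a b]] := le_dir i1 j1.
  by have [k2 [c d]] := le_dir i2 j2; exists (k1, k2).
Qed.

(** Every functional is a difference of two positive ones. *)
Lemma weak_null_nneg (I : Type) (le : I -> I -> Prop) (x : I -> E) :
  directed le -> (forall i, 0 <= x i) ->
  (forall f (e : R), nneg_dual f -> 0 < e -> exists i, forall j, le i j ->
    f (x j) < e) ->
  weak_cvg le x 0.
Proof.
move=> dir x0 xf f; have FF := tails_filter dir.
have cvg0 g : nneg_dual g -> g (x i) @[i --> tails le] --> (0 : R).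
  move=> g0; apply/cvgrPdist_lt => e e0; have [i ie] := xf g e g0 e0.
  exists i => // j /= ij; rewrite sub0r normrN ger0_norm; first exact: ie.
  exact: g0 (x0 j).
have [p [q [p0 q0 ->]]] := lcone_diff f (@nneg_dual_lattice_cone R E).
by rewrite dual0 -[0]subr0; apply: cvgB; exact: cvg0.
Qed.

Lemma uaw_cauchy_nneg (I : Type) (le : I -> I -> Prop) (x : I ->
  E) : directed le ->
  (forall f u (e : R), nneg_dual f -> 0 <= u -> 0 < e ->
     exists i, forall j k, le i j -> le i k ->
       f (modulus (x j - x k) `&` u)%O < e) ->
  uaw_cauchy le x.
Proof.
move=> dir xf u u0; apply: weak_null_nneg.
- exact: directed_prod_le.
- by move=> p; rewrite meet_ge0// modulus_ge0.
- move=> f e f0 e0; have [i ie] := xf f u e f0 u0 e0.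
  by exists (i, i) => -[j k] [/= ij ik]; rewrite subr0; exact: ie.
Qed.

(** The sum of two disjoint positive vectors is their supremum. *)
Lemma sum_disjoint_le (v : nat -> E) u : 0 <= u ->
  (forall n, 0 <= v n) -> (forall n, v n <= u) ->
  (forall m n, (m < n)%N -> (v m `&` v n)%O = 0) ->
  forall n, series v n <= u.
Proof.
move=> u0 v0 vu vdisj n.
suff [//] : [/\ series v n <= u, 0 <= series v n &
    forall m, (n <= m)%N -> (series v n `&` v m)%O = 0].
rewrite /series /=; elim: n => [|n [su s0 sdisj]].
  rewrite big_geq//; split => // m _; apply: meet_l; exact: v0.
rewrite big_nat_recr//=; set s := \sum_(0 <= k < n) v k in su s0 sdisj *.
split.
- by rewrite -join_add_meet sdisj// addr0 leUx su vu.
- exact: addE_ge0.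
- move=> m nm; apply/le_anti; rewrite meet_ge0 ?addE_ge0// andbT.
  by rewrite (le_trans (meetD_le _ _ _))// sdisj ?(ltnW nm)// vdisj// addr0.
Qed.

(** The values f(w_n /\ u) are summable: the w_n /\ u are disjoint, so their
    partial sums stay below u. *)
Lemma disjoint_unbounded_null f u (w : nat -> E) (e : R) :
  nneg_dual f -> 0 <= u -> 0 < e -> (forall n, 0 <= w n) ->
  (forall m n, (m < n)%N -> (w m `&` w n)%O = 0) ->
  exists N, forall n, (N <= n)%N -> f (w n `&` u)%O < e.
Proof.
move=> f0 u0 e0 w0 wdisj.
pose v n := (w n `&` u)%O.
have v0 n : 0 <= v n by exact: meet_ge0.
have vdisj m n : (m < n)%N -> (v m `&` v n)%O = 0.
  move=> mn; apply/le_anti; rewrite meet_ge0// andbT -(wdisj _ _ mn).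
  by rewrite leI2// leIl.
have vu n : v n <= u by exact: leIr.
have sv := sum_disjoint_le u0 v0 vu vdisj.
have fs n : f (series v n) = series (fun k => f (v k)) n.
  by rewrite /series /=; exact: linear_sum.
have /cvg_series_cvg_0/cvgrPdist_lt/(_ _ e0)[N _ HN] :
  cvgn (series (fun k => f (v k))).
  apply: nondecreasing_is_cvgn.
    by apply: nondecreasing_series => k _ _; exact: f0 (v0 k).
  by exists (f u) => _ [n _ <-]; rewrite -fs ler_nneg_dual.
exists N => n Nn; have := HN n Nn; rewrite /= sub0r normrN.
exact: le_lt_trans (ler_norm _).
Qed.

Definition uaw_cauchy_sequences_converge : Prop :=
  forall x : nat -> E, bounded_set (range x) -> uaw_cauchy nat_le x ->
    exists l : E, weak_cvg nat_le x l.

(** Interleave the sequence with zeros: the resulting sequence is uaw-Cauchy,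
    and a limit of f along it is also a limit along its zero terms. *)
Lemma sequences_disjoint_null :
  uaw_cauchy_sequences_converge -> disjoint_sequences_null (E := E).
Proof.
move=> conv f w M d f0 w0 wdisj wM d0.
have M0 : 0 <= M by exact: le_trans (wM 0%N).
pose y n := if odd n then 0 else w n./2.
have y0 n : 0 <= y n by rewrite /y; case: ifP.
have [||l yl] := conv y.
- apply/bounded_rangeP; exists M => n; rewrite /y; case: ifP => // _.
  by rewrite normr0.
- apply: (uaw_cauchy_nneg directed_nat_le) => g u e g0 u0 e0.
  have e20 : 0 < e / 2 by rewrite divr_gt0.
  have [N HN] := disjoint_unbounded_null g0 u0 e20 w0 wdisj.
  have yN n : (N.*2 <= n)%N -> g (y n `&` u)%O < e / 2.
    rewrite /y => Nn; case: ifP => _; first by rewrite meet_l// dual0.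
    by apply: HN; rewrite -(doubleK N) half_leq.
  exists N.*2 => m n Nm Nn.
  have : (modulus (y m - y n) `&` u <= (y m `&` u) + (y n `&` u))%O.
    apply: le_trans (meetD_le (y0 m) (y0 n) u0).
    by rewrite leI2// modulusB_le.
  move=> /(ler_nneg_dual g0); rewrite dualD.
  by have := yN m Nm; have := yN n Nn; lra.
have d20 : 0 < d / 2 by rewrite divr_gt0.
have /cvgrPdist_lt/(_ _ d20)[N _ HN] := yl f.
have N2 : (N <= N.*2)%N by rewrite -addnn leq_addr.
have := HN N.*2.+1 (leqW N2); have := HN N.*2 N2.
rewrite /= /y /= odd_double /= doubleK dual0 subr0 => fw fl.
exists N; have := ler_norm (f (w N) - f l); rewrite distrC.
by have := ler_norm (f l); lra.
Qed.

(** For f >= 0 and an increasing sequence, f(|y_m - y_n|) = |f(y_m) - f(y_n)|,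
    so the sequence is uaw-Cauchy because f(y_n) converges. *)
Lemma sequences_monotone_complete :
  uaw_cauchy_sequences_converge -> monotone_complete (E := E).
Proof.
move=> conv y M yS yM.
have [||l yl] := conv y.
- by apply/bounded_rangeP; exists M.
- apply: (uaw_cauchy_nneg directed_nat_le) => f u e f0 u0 e0.
  have fy : cvgn (fun n => f (y n)).
    apply: nondecreasing_is_cvgn => [m n mn|].
      by rewrite ler_nneg_dual// increasing_le.
    exists (`|f| * M) => _ [n _ <-].
    by rewrite (le_trans (ler_dual f _))// ler_wpM2l ?dual_norm_ge0.
  have fmod m n : f (modulus (y m - y n)) = `|f (y m) - f (y n)|.
    wlog mn : m n / (m <= n)%N.
      move=> H; have [/H//|/ltnW/H] := leqP m n.
      by rewrite distrC -modulusN opprB.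
    have ymn : 0 <= y n - y m by rewrite leB0 increasing_le.
    rewrite -modulusN opprB ge0_modulus// dualB distrC ger0_norm//.
    by rewrite -dualB; exact: f0.
  have e20 : 0 < e / 2 by rewrite divr_gt0.
  move/cvgrPdist_lt : fy => /(_ _ e20)[N _ HN].
  exists N => m n /HN/= fm /HN/= fn; set c := lim _ in fm fn.
  apply: (@le_lt_trans _ _ (f (modulus (y m - y n)))).
    by rewrite ler_nneg_dual// leIl.
  rewrite fmod; have := ler_distD c (f (y m)) (f (y n)).
  by rewrite [`|f (y m) - c|]distrC; lra.
by exists l; apply: increasing_weak_cvg.
Qed.

(** With N bounding the norms of all differences d, the part of d above N u is
    N times the part of d / N above u, which f hardly sees; the part below N u
    is handled by the uaw-Cauchy condition. *)
Lemma reflexive_nets_converge (I : Type) (le : I -> I -> Prop) (x : I -> E) :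
  reflexive_space E -> directed le -> bounded_set (range x) ->
    uaw_cauchy le x ->
  exists l : E, weak_cvg le x l.
Proof.
move=> refl dir /bounded_rangeP[M xM] xc.
have aob := disjoint_null_almost_order_bounded (reflexive_disjoint_null refl).
have [[i0] le_refl leT le_dir] := dir.
have FF := tails_filter dir; have FF2 := tails_filter (directed_prod_le dir).
have M0 : 0 <= M by exact: le_trans (normr_ge0 _) (xM i0).
pose N := 2 * M + 1.
have N0 : 0 < N by rewrite ltr_wpDl// mulr_ge0.
have small f (e : R) : nneg_dual f -> 0 < e -> exists i, forall j k,
    le i j -> le i k -> f (modulus (x j - x k)) < e.
  move=> f0 e0; have e10 : 0 < e / (2 * N) by rewrite divr_gt0// mulr_gt0.
  have e20 : 0 < e / 2 by rewrite divr_gt0.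
  have [u u0 fu] := aob f _ f0 e10.
  have Nu0 : 0 <= N *: u by rewrite scaleE_ge0// ltW.
  have /cvgrPdist_lt/(_ _ e20)[[i1 i2] _ Hi] := xc _ Nu0 f.
  have [i [i1i i2i]] := le_dir i1 i2.
  exists i => j k ij ik; set d := modulus _.
  have d0 : 0 <= d by exact: modulus_ge0.
  have := Hi (j, k) (conj (leT _ _ _ i1i ij) (leT _ _ _ i2i ik)).
  rewrite /= dual0 subr0 sub0r normrN -/d => /(le_lt_trans (ler_norm _)).
  have -> : f d = f (d `&` N *: u)%O + f (pos (d - N *: u)).
    by rewrite -dualD meet_add_pos.
  have -> : pos (d - N *: u) = N *: pos (N^-1 *: d - u).
    by rewrite -posZ// scalerBr scalerA mulfV ?gt_eqF// scale1r.
  have : f (pos (N^-1 *: d - u)) <= e / (2 * N).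
    apply: fu; first by rewrite scaleE_ge0// invr_ge0 ltW.
    rewrite normrZ gtr0_norm ?invr_gt0// ler_pdivrMl// mulr1 norm_modulus.
    have := ler_normB (x j) (x k); have := xM j; have := xM k.
    by rewrite /N; lra.
  rewrite dualZ -(ler_pM2l N0).
  have -> : N * (e / (2 * N)) = e / 2 by field; rewrite gt_eqF.
  by lra.
have fcvg f : cvg (f (x i) @[i --> tails le]).
  apply: cauchy_cvg; apply/cauchyP => e e0.
  have [p [q [p0 q0 fE]]] := lcone_diff f (@nneg_dual_lattice_cone R E).
  have e20 : 0 < e / 2 by rewrite divr_gt0.
  have [i Hi] := small p _ p0 e20; have [j Hj] := small q _ q0 e20.
  have [k [ik jk]] := le_dir i j.
  exists (f (x k)); exists k => // m /= km.
  rewrite /ball /= -dualB fE dualEB.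
  have := ler_normB (p (x k - x m)) (q (x k - x m)).
  have := nneg_dual_abs (x k - x m) p0; have := nneg_dual_abs (x k - x m) q0.
  have := Hi k m ik (leT _ _ _ ik km).
  have := Hj k m jk (leT _ _ _ jk km).
  by lra.
pose L f : R := lim (f (x i) @[i --> tails le]).
have [T TL] : exists T : dual (dual E), forall f, T f = L f.
  apply: (@dual_of_linear _ _ _ M) => [a f g|f].
    by apply: cvg_lim => //; apply: cvgD; [apply: cvgM;
      [exact: cvg_cst|exact: fcvg]|exact: fcvg].
  have fM i : `|f (x i)| <= M * `|f|.
    rewrite mulrC; apply: le_trans (ler_dual_norm f (x i)) _.
    by rewrite ler_wpM2l ?dual_norm_ge0.
  rewrite ler_norml; apply/andP; split; [apply: limr_ge|apply: limr_le] => //;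
    by apply: nearW => i; have := fM i; rewrite ler_norml => /andP[].
have : [set: dual (dual E)] T by [].
rewrite -refl => -[l _ lT]; exists l => f.
have -> : f l = L f by rewrite -TL -lT.
exact: fcvg.
Qed.

End nets_and_sequences.

Theorem theorem8 (R : realType) (E : banachLatticeType R) :
  [<-> reflexive_space E;
       forall (I : Type) (le : I -> I -> Prop) (x : I -> E),
         directed le -> bounded_set (range x) -> uaw_cauchy le x ->
         exists l : E, weak_cvg le x l;
       forall x : nat -> E,
         bounded_set (range x) -> uaw_cauchy (fun m n => (m <= n)%N) x ->
         exists l : E, weak_cvg (fun m n => (m <= n)%N) x l].
Proof.
tfae.
- by move=> refl I le x; exact: reflexive_nets_converge.
- by move=> nets x; apply: nets; exact: directed_nat_le.
- move=> conv; apply: monotone_complete_reflexive.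
    exact: sequences_monotone_complete.
  exact/disjoint_null_almost_order_bounded/sequences_disjoint_null.
Qed.
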